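(* Let $MG_{1,1}(n,m)$ be the multi-digraph on $[n]$ determined by an $m$-long insertion sequence chosen uniformly at random among all $m$-long insertion sequences whose multi-digraph has all in-degrees and out-degrees at least $1$. Let $X$ be the number of vertices of $MG_{1,1}(n,m)$ lying on some sink cycle or source cycle. Suppose $r:=m-n\to\infty$ and $m=O(n)$, and let $\lambda>0$ be the root of $\lambda e^{\lambda}/(e^{\lambda}-1)=m/n$. Then $$ \Pr(X=0)=\frac{\left(1-\frac{\lambda}{e^{\lambda}-1}\right)^2}{1-\frac{\lambda}{e^{\lambda}(e^{\lambda}-1)}}\bigl(1+O(r^{-1}\ln^2r)\bigr). $$
   Context: An $m$-long insertion sequence is a sequence of $m$ ordered pairs $(j_t,i_t)\in[n]^2$; its multi-digraph on $[n]$ (loops and multiple arcs allowed) has as many arcs $j\to i$ as there are indices $t$ with $(j_t,i_t)=(j,i)$. A nonempty vertex set $C$ is a cycle of a multi-digraph if the sub-multi-digraph induced by $C$ is a single directed cycle (for $|C|=1$: a single loop of multiplicity one); it is a sink cycle if no arc goes from $C$ to its complement, and a source cycle if no arc goes from its complement to $C$. *)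

(* Defs.v *)
From HB Require Import structures.
From mathcomp Require Import all_boot all_order all_algebra.
From mathcomp Require Import all_classical all_reals all_analysis.

Set Implicit Arguments.
Unset Strict Implicit.
Unset Printing Implicit Defensive.

Import Order.TTheory GRing.Theory Num.Theory.
Import numFieldNormedType.Exports.

(* [G j i] is the multiplicity of the arc [j -> i]. *)
Definition multidigraph (n : nat) : Type := 'I_n -> 'I_n -> nat.

Section Multidigraph.
Local Open Scope nat_scope.
Variables (n : nat) (G : multidigraph n).

Definition in_degree (i : 'I_n) : nat := \sum_(j < n) G j i.
Definition out_degree (j : 'I_n) : nat := \sum_(i < n) G j i.

Definition min_degrees_ge1 : bool :=
  [forall v : 'I_n, (0 < in_degree v) && (0 < out_degree v)].

(* [c] lists [C] in cyclic order; for #|C| = 1 the vertex is its own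
   successor under [next], so the arc required is a single loop. *)
Definition is_cycle (C : {set 'I_n}) : bool :=
  (C != finset.set0) &&
  [exists c : #|C|.-tuple 'I_n,
    [&& uniq c, C == [set:: c]%SET
      & [forall j in C, forall i in C, G j i == (next c j == i)]]].

Definition is_sink_cycle (C : {set 'I_n}) : bool :=
  is_cycle C && [forall j in C, forall i in ~: C, G j i == 0].

Definition is_source_cycle (C : {set 'I_n}) : bool :=
  is_cycle C && [forall j in ~: C, forall i in C, G j i == 0].

Definition nb_sink_source_cycle_vertices : nat :=
  #|[set v : 'I_n |
      [exists C : {set 'I_n},
        (v \in C) && (is_sink_cycle C || is_source_cycle C)]]%SET|.

End Multidigraph.

Definition insertion_sequence (n m : nat) : finType :=
  (m.-tuple ('I_n * 'I_n))%type.

Definition multidigraph_of (n m : nat) (s : insertion_sequence n m) :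
    multidigraph n :=
  fun j i => count_mem (j, i) s.

Definition sequences_1_1 (n m : nat) : {set insertion_sequence n m} :=
  [set s | min_degrees_ge1 (multidigraph_of s)]%SET.

Section Probability.
Local Open Scope ring_scope.

Definition uniform_prob (R : realType) (T : finType) (A : {set T})
    (E : pred T) : R :=
  #|[set x in A | E x]%SET|%:R / #|A|%:R.

Definition prob_X_eq0 (R : realType) (n m : nat) : R :=
  uniform_prob R (sequences_1_1 n m)
    (fun s => nb_sink_source_cycle_vertices (multidigraph_of s) == 0%N).

Definition main_term (R : realType) (l : R) : R :=
  (1 - l / (expR l - 1)) ^+ 2 / (1 - l / (expR l * (expR l - 1))).

End Probability.

(* Main.v *)
(* An insertion sequence is a pair of surjections from the arcs to the vertices
   (tails and heads).  The indicator of "no sink cycle" is the determinant of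
   1 - Phi, where Phi is the 0/1 matrix of the arcs that are alone in leaving
   their tail, and dually for source cycles.  In the product of the two Leibniz
   expansions everything cancels but the pairs of partial permutations whose
   supports differ by at most one vertex on each side.  This leaves an exact
   recurrence P(m, n) = beta + f P(m - 1, n - 1), where beta and f depend only on
   rho(m, n) = m s(m - 1, n - 1) / s(m, n), with s(m, n) the number of surjections.

   Put q(x) = x / (e^x - 1) and z(x) = x + q(x), so that z(lambda) = m / n.  Then
   sigma = m / n - rho satisfies a recurrence of which lambda is the approximate
   solution, and lambda <= sigma <= lambda + 12 / n follows by induction from
   Cauchy's mean value theorem applied to ln q and ln z.  The announced limit G
   is the fixed point of the recurrence for P at rho = q(lambda); the errors made
   at each step are absorbed by the contraction, whence |P - G| = O(1 / n), while
   G is at least of order r / n. *)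
Require Import Defs.
From HB Require Import structures.
From mathcomp Require Import all_boot all_order all_algebra all_fingroup zify ring lra.

Set Implicit Arguments.
Unset Strict Implicit.
Unset Printing Implicit Defensive.

Import Order.TTheory GRing.Theory Num.Theory.

(** * Sink cycles and the determinant of the forced-arc matrix *)

Section SinkCycles.
Variables (n : nat) (G : multidigraph n).
Implicit Types (K C : {set 'I_n}) (s : {perm 'I_n}).

(** [K] is the set of rows from which a Leibniz product takes the forced-arc entry; the other rows
    contribute their entry of the identity matrix. *)
Definition sink_perm K s : bool :=
  [forall v in K, (out_degree G v == 1) && (G v (s v) == 1)].

Lemma out_degree1_arc (v w u : 'I_n) :
  out_degree G v = 1 -> G v w = 1 -> G v u = (w == u).
Proof.
rewrite /out_degree (bigD1 w) //= => + Gvw; rewrite Gvw => -[/eqP].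
rewrite sum_nat_eq0 => /forall_inP Gv0.
case: (eqVneq w u) => [<- //|]; rewrite eq_sym => /Gv0/eqP -> //.
Qed.

(** The orbit of [v] under [s] is the cycle: it stays in [K], and the only arc leaving each of its
    vertices goes to the next one. *)
Lemma sink_perm_cycle K s (v : 'I_n) : perm_on K s -> sink_perm K s ->
  v \in K -> [exists C, is_sink_cycle G C].
Proof.
move=> Ks /forall_inP sK vK.
pose C : {set 'I_n} := [set:: fingraph.orbit s v].
have sizeC : size (fingraph.orbit s v) == #|C|.
  by rewrite cardsE; apply/eqP; rewrite (card_uniqP (orbit_uniq _ _)).
have CK u : u \in C -> u \in K.
  rewrite inE -fconnect_orbit => /iter_findex <-.
  by elim: (findex _ _ _) => //= k IH; rewrite perm_closed.
have arcC u w : u \in C -> G u w = (s u == w).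
  move=> /CK/sK/andP[/eqP d /eqP g]; exact: out_degree1_arc.
have sC u : u \in C -> s u \in C.
  rewrite !inE -!fconnect_orbit => vu; apply: connect_trans vu (fconnect1 _ _).
apply/existsP; exists C; apply/andP; split; last first.
  apply/forall_inP => u uC; apply/forall_inP => w; rewrite inE => wC.
  rewrite arcC // (_ : s u == w = false) //; apply: contraNF wC => /eqP <-; exact: sC.
apply/andP; split.
  by apply/set0Pn; exists v; rewrite inE -fconnect_orbit connect0.
apply/existsP; exists (Tuple sizeC) => /=; rewrite orbit_uniq eqxx /=.
apply/forall_inP => u uC; apply/forall_inP => w wC; rewrite arcC //.
have := cycle_orbit (@perm_inj _ s) v.
by move=> /next_cycle/(_ (_ : u \in _))/eqP -> //; move: uC; rewrite inE.
Qed.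

Local Open Scope ring_scope.

(** The indicator row vector of [C] lies in the left kernel: [next c] is a bijection of all vertices
    that preserves [C], so in each column the forced arcs of [C] cancel the diagonal. *)
Lemma det_sink (F : idomainType) :
  [exists C, is_sink_cycle G C] ->
  \det (\matrix_(v < n, u < n)
    ((v == u)%:R - ((out_degree G v == 1%N) && (G v u == 1%N))%:R)) = 0 :> F.
Proof.
case/existsP => C /andP[/andP[/set0Pn[x xC] /existsP[c /and3P[uc /eqP defC]]]].
move=> /forall_inP cycC /forall_inP sinkC.
have inC u : (u \in C) = (u \in val c).
  by have /setP/(_ u) := defC; rewrite inE.
have arcC v u : v \in C -> G v u = (next c v == u).
  move=> vC; case: (boolP (u \in C)) => [uC|uC].
    by move/forall_inP: (cycC v vC) => /(_ u uC)/eqP.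
  have := sinkC v vC => /forall_inP/(_ u); rewrite inE => /(_ uC)/eqP ->.
  case: eqP => // e; move: uC; rewrite -e inC mem_next -inC vC //.
have degC v : v \in C -> out_degree G v = 1%N.
  move=> vC; rewrite /out_degree (bigD1 (next c v)) //= arcC // eqxx.
  rewrite big1 ?addn0 // => u une; rewrite arcC //.
  by rewrite eq_sym (negPf une).
apply/eqP/det0P; exists (\row_v (v \in C)%:R).
  apply/eqP => /rowP/(_ x); rewrite !mxE xC => /eqP; by rewrite oner_eq0.
apply/rowP => u; rewrite !mxE.
rewrite (eq_bigr (fun v => (v \in C)%:R * (v == u)%:R
    - (v \in C)%:R * (next c v == u)%:R)); last first.
  move=> v _; rewrite !mxE mulrBr; congr (_ - _).
  case: (boolP (v \in C)) => vC; rewrite ?mul0r // degC // arcC //=.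
  by case: (next c v == u).
rewrite sumrB (bigD1 u) //= eqxx mulr1 big1 ?addr0; last first.
  by move=> v /negPf ->; rewrite mulr0.
rewrite (bigD1 (prev c u)) //= next_prev // eqxx mulr1 big1 ?addr0.
  by rewrite !inC mem_prev subrr.
move=> v vne; case: eqP => e; rewrite ?mulr0 //.
by move: vne; rewrite -e prev_next // eqxx.
Qed.

(* The Leibniz expansion of the determinant of the identity minus the matrix of
   forced arcs; this determinant is 1 or 0 according to the absence or
   presence of sink cycles. *)
Lemma signed_sum_sink_perm (F : idomainType) :
  \sum_(s : {perm 'I_n}) \sum_(K : {set 'I_n} | perm_on K s)
    (-1) ^+ s * (-1) ^+ #|K| * (sink_perm K s)%:R =
  (~~ [exists C, is_sink_cycle G C])%:R :> F.
Proof.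
case: (boolP [exists C, _]) => exC /=.
  rewrite -[RHS](det_sink F exC) /determinant; apply: eq_bigr => s _.
  under [in RHS]eq_bigr => v _ do rewrite mxE addrC.
  (* Choosing in each row the identity or the forced-arc entry gives a sum over [K]. If [s] moves a
     point outside [K], the identity entry there is 0. *)
  rewrite bigA_distr big_distrr /= [RHS](bigID (fun K => perm_on K s)) /=.
  rewrite [X in _ = _ + X]big1 ?addr0; last first.
    move=> K; rewrite /perm_on => /subsetPn[v]; rewrite inE => svv vK.
    by rewrite (bigD1 v) //= (negPf vK) eq_sym (negPf svv) mul0r mulr0.
  apply: eq_bigr => K Ks; rewrite -mulrA; congr (_ * _).
  rewrite (bigID (mem K)) /= [X in _ = _ * X]big1 ?mulr1; last first.
    by move=> v vK; rewrite (negPf vK) (out_perm Ks) ?eqxx.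
  under eq_bigr => v vK do rewrite vK -mulN1r.
  rewrite big_split /= prodr_const; congr (_ * _).
  case: (boolP (sink_perm K s)) => [/forall_inP sK|].
    by rewrite big1 // => v /sK ->.
  rewrite negb_forall_in => /exists_inP[v vK /negPf e].
  by rewrite (bigD1 v) //= e mul0r.
(* Without sink cycles only the empty [K], hence the identity permutation, contributes. *)
rewrite (bigD1 1%g) //= (bigD1 finset.set0) ?perm_on1 //=.
rewrite odd_perm1 cards0 !expr0 !mul1r.
have -> : sink_perm finset.set0 1%g by apply/forall_inP => v; rewrite inE.
have sink0 K s : perm_on K s -> K != finset.set0 -> sink_perm K s = false.
  move=> Ks /set0Pn[v vK]; apply/negP => sK; move/negP: exC; apply.
  exact: sink_perm_cycle Ks sK vK.
rewrite big1 ?addr0; last first.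
  by move=> K /andP[Ks K0]; rewrite sink0 // mulr0.
rewrite big1 ?addr0 // => s s1; rewrite big1 // => K Ks.
rewrite sink0 ?mulr0 //; apply: contra s1 => /eqP K0; apply/eqP/permP => v.
by rewrite perm1 (out_perm Ks) // K0 inE.
Qed.

End SinkCycles.

(** * Maps covering a prescribed set *)

(* The number of maps from p points to c + d points that hit the first c points;
   in particular cov m n 0 is the number of surjections. *)
Fixpoint cov (p c d : nat) : nat :=
  if p is q.+1 then c * cov q c.-1 d.+1 + d * cov q c d else c == 0.

(** Split according to whether the additional free point is missed or hit. *)
Lemma covS p c d : cov p c d.+1 = cov p c d + cov p c.+1 d.
Proof.
elim: p c d => [|p IH] c d /=; first by rewrite addn0.
case: c => [|c] /=.
  rewrite !mul0n !add0n mul1n mulSn IH; nia.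
rewrite !IH; nia.
Qed.

(** Off [D] the map is frozen to [f0]; this lets an induction on [D] fix the values one at a
    time. *)
Definition covering_ffuns (E V : finType) (D : {set E}) (C O : {set V})
    (f0 : E -> V) : {set {ffun E -> V}} :=
  [set f : {ffun E -> V} |
    [forall t, if t \in D then f t \in C :|: O else f t == f0 t] &&
    [forall c in C, [exists t in D, f t == c]]].

(** The recursion of [cov] follows the value [x] at one point of [D]: once taken, [x] need not be
    hit again but stays allowed, so it moves from [C] to [O] or remains in [O]. *)
Lemma card_covering_ffuns (E V : finType) (D : {set E}) (C O : {set V})
    (f0 : E -> V) : [disjoint C & O] ->
  #|covering_ffuns D C O f0| = cov #|D| #|C| #|O|.
Proof.
elim: {D}#|D| {-2}D (erefl #|D|) C O f0 => [|p IH] D cD C O f0 dCO /=.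
  have D0 : D = set0 by apply/eqP; rewrite -cards_eq0 cD.
  case: (eqVneq #|C| 0) => [/cards0_eq C0|]; last first.
    rewrite cards_eq0 => /set0Pn[c cC]; rewrite (_ : cov _ _ _ = 0); last first.
      by rewrite cD /=; apply/eqP; rewrite eqb0 cards_eq0; apply/set0Pn; exists c.
    apply/eqP; rewrite cards_eq0.
    apply: contraTT isT => /set0Pn[f]; rewrite inE => /andP[_ /forall_inP/(_ c cC)].
    by case/existsP => t; rewrite D0 inE.
  transitivity #|[set finfun f0]|; last by rewrite cards1 cD C0 cards0.
  apply: eq_card => f; rewrite !inE.
  apply/andP/eqP => [[/forallP h _]|->].
    by apply/ffunP => t; have := h t; rewrite D0 inE ffunE => /eqP.
  split; last by apply/forall_inP => c; rewrite C0 inE.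
  by apply/forallP => t; rewrite D0 inE ffunE.
have [e eD] : exists e, e \in D by apply/set0Pn; rewrite -cards_eq0 cD.
have cDe : #|D :\ e| = p by have := cardsD1 e D; rewrite eD cD => -[].
have fib x : x \in C :|: O ->
    #|[set f in covering_ffuns D C O f0 | f e == x]| =
    cov p #|C :\ x| #|x |: O|.
  move=> xCO; rewrite -cDe -(IH _ cDe _ _ [eta f0 with e |-> x]); last first.
    rewrite -setI_eq0; apply/eqP/setP => y; rewrite !inE.
    case: eqP => //= _; move/pred0P: dCO => /(_ y) /=.
    by [].
  have xCOE : (C :\ x) :|: (x |: O) = C :|: O.
    apply/setP => y; rewrite !inE; case: eqP => [->|//=].
    by rewrite /=; move: xCO; rewrite inE => ->.
  apply: eq_card => f; rewrite !inE xCOE /=; apply/andP/andP => [[]|[]].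
    case/andP => /forallP h1 /forall_inP h2 /eqP fe; split.
      apply/forallP => t; rewrite !inE; have := h1 t.
      case: (eqVneq t e) => [->|_] /=; first by rewrite fe eqxx.
      by rewrite !inE.
    apply/forall_inP => c; rewrite !inE => /andP[cx cC].
    have /existsP[t /andP[tD /eqP ft]] := h2 c cC.
    apply/existsP; exists t; rewrite !inE tD ft eqxx !andbT.
    by apply: contraNN cx => /eqP te; rewrite -ft te fe.
  move=> /forallP h1 /forall_inP h2.
  have fe : f e = x by have := h1 e; rewrite !inE eqxx /= => /eqP.
  split; last exact/eqP; apply/andP; split.
    apply/forallP => t; have := h1 t; rewrite !inE.
    by case: (eqVneq t e) => [->|] //=; rewrite eD fe -in_setU.
  apply/forall_inP => c cC; case: (eqVneq c x) => [->|cx].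
    by apply/existsP; exists e; rewrite eD fe eqxx.
  have := h2 c; rewrite !inE cx => /(_ cC)/existsP[t].
  rewrite inE => /andP[/andP[_ tD] ft]; by apply/existsP; exists t; rewrite tD.
rewrite cD /=.
transitivity (\sum_(x in C :|: O) cov p #|C :\ x| #|x |: O|).
  rewrite -sum1_card (partition_big (fun f : {ffun E -> V} => f e) (mem (C :|: O))) /=;
    last by move=> f; rewrite inE => /andP[/forallP/(_ e)]; rewrite eD.
  apply: eq_bigr => x xCO; rewrite -fib // -sum1_card; apply: eq_bigl => f.
  by rewrite !inE.
rewrite (eq_bigl [in [predU C & O]]) => [|x]; last by rewrite !inE.
rewrite bigU //=; congr (_ + _).
  rewrite -sum_nat_const; apply: eq_bigr => x xC.
  rewrite cardsU1 (disjointFr dCO) // add1n.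
  by rewrite [in RHS](cardsD1 x C) xC.
rewrite -sum_nat_const; apply: eq_bigr => x xO.
rewrite cardsU1 xO add0n; congr (cov _ _ _).
by rewrite [in RHS](cardsD1 x C) (disjointFl dCO).
Qed.

(** * Pairs of surjections with prescribed forced arcs *)

Definition surjectiveb (E V : finType) (j : {ffun E -> V}) : bool :=
  [forall v, exists t, j t == v].

(* Each vertex of [K] has a single arc [t] leaving it, with head [s v]; here
   [j t] is the tail and [i t] the head of the arc [t]. *)
Definition forced_arcs (E V : finType) (j i : {ffun E -> V}) (K : {set V})
    (s : V -> V) : bool :=
  [forall v in K, exists t, [forall t', (j t' == v) == (t' == t)] && (i t == s v)].

Lemma forced_arcsP (E V : finType) (j i : {ffun E -> V}) (K : {set V}) s :
  reflect (forall v, v \in K ->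
    exists t, (forall t', (j t' == v) = (t' == t)) /\ i t = s v)
    (forced_arcs j i K s).
Proof.
apply: (iffP forall_inP) => h v /h.
  by case/existsP => t /andP[/forallP h1 /eqP h2]; exists t; split => // t'; exact: (eqP (h1 t')).
case=> t [h1 h2]; apply/existsP; exists t; rewrite h2 eqxx andbT.
by apply/forallP => t'; rewrite h1.
Qed.

Section CountForced.
Variables (E V : finType) (v0 : V) (K L : {set V}) (s r : {perm V}).
Hypotheses (Ks : perm_on K s) (Lr : perm_on L r).

Local Notation P := (K :|: L).
Local Notation sP := {v : V | v \in P}.
Local Notation mkP h := (exist (fun v => is_true (v \in P)) _ h).

(** [g] reserves an arc for each vertex of [P], and [h] prescribes one end of it. The default [v0]
    concerns only unreserved arcs, whose ends are free. *)
Definition arcs_to_vertices (g : {ffun sP -> E}) (h : V -> V) (t : E) : V :=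
  if [pick v | g v == t] is Some v then h (val v) else v0.

(** Unreserved arcs must reach every vertex outside [P] and avoid [A], whose vertices admit reserved
    arcs only. *)
Definition placements (g : {ffun sP -> E}) (A : {set V}) (h : V -> V) :=
  covering_ffuns (~: [set g v | v : sP]) (~: P) (P :\: A)
    (arcs_to_vertices g h).

Lemma placementsP (g : {ffun sP -> E}) (A : {set V}) h (j : {ffun E -> V}) :
  injective g -> A \subset P ->
  reflect [/\ forall v : sP, j (g v) = h (val v),
     forall t, j t \in A -> exists v : sP, t = g v &
     forall u, u \notin P -> exists2 t, (forall v : sP, t != g v) & j t = u]
   (j \in placements g A h).
Proof.
move=> gI AP.
have f0g v : arcs_to_vertices g h (g v) = h (val v).
  rewrite /arcs_to_vertices; case: pickP => [w /eqP/gI -> //|/(_ v)].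
  by rewrite eqxx.
have inim t : reflect (exists v : sP, t = g v) (t \in [set g v | v : sP]).
  apply: (iffP imsetP) => [[v _ ->]|[v ->]]; first by exists v.
  by exists v.
have CO : ~: P :|: P :\: A = ~: A.
  apply/setP => v; rewrite !inE; move/subsetP: AP => /(_ v); rewrite !inE.
  by case: (v \in A) => [->|] //; case: (_ || _).
rewrite inE CO; apply: (iffP andP) => [[/forallP h1 /forall_inP h2]|[h1 h2 h3]].
  split=> [v|t tA|u uP].
  - by have := h1 (g v); rewrite inE imset_f //= f0g => /eqP.
  - by apply/inim; have := h1 t; rewrite !inE tA; case: (t \in _).
  have := h2 u; rewrite inE => /(_ uP)/existsP[t /andP[tim /eqP jt]].
  by exists t => // v; apply: contraTneq tim => ->; rewrite inE negbK imset_f.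
split.
  apply/forallP => t; rewrite !inE; case: ifP => [tim|/negbFE/inim[v ->]].
    by apply: contraNN tim => /h2/inim.
  by rewrite f0g h1.
apply/forall_inP => u; rewrite inE => /h3[t tg jt]; apply/existsP; exists t.
rewrite jt eqxx andbT inE; apply/inim => -[v /eqP]; apply/negP; exact: tg.
Qed.

Lemma card_placements (g : {ffun sP -> E}) (A : {set V}) h :
  injective g ->
  #|placements g A h| = cov (#|E| - #|P|) (#|V| - #|P|) #|P :\: A|.
Proof.
move=> gI; rewrite card_covering_ffuns; last first.
  rewrite -setI_eq0; apply/eqP/setP => v; rewrite !inE.
  by case: (_ \in K); case: (_ \in L); rewrite ?andbF.
congr (cov _ _ _); rewrite cardsCs setCK //.
by rewrite card_imset // card_sig.
Qed.

(** The arc reserved for [v] is to have tail [v] and head [next_vertex v]: for [v] in [K] it is the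
    only arc leaving [v], for [v] in [L] the only arc entering [r v]. *)
Let next_vertex v := if v \in K then s v else r v.

Let rV (v : V) : (r^-1%g v \in L) = (v \in L).
Proof. by rewrite -(perm_closed _ Lr) permKV. Qed.

Let sV (v : V) : (s^-1%g v \in K) = (v \in K).
Proof. by rewrite -(perm_closed _ Ks) permKV. Qed.

Section Compatible.
Hypothesis sr : forall v, v \in K -> v \in L -> s v = r v.

Let next_K v : v \in K -> next_vertex v = s v.
Proof. by rewrite /next_vertex => ->. Qed.

Let next_L v : v \in L -> next_vertex v = r v.
Proof. by rewrite /next_vertex; case: ifP => // vK vL; rewrite sr. Qed.

(** The delicate case is [u] in [K]. Since [s] and [r] agree on the intersection, [s] maps it into,
    hence onto, itself; so a point of [K] that [s] sends into [L] was already in [L]. *)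
Let next_inv u w : u \in P -> w \in L -> next_vertex u = w -> u = r^-1%g w.
Proof.
rewrite inE => /orP[uK|uL] wL; last by rewrite next_L // => <-; rewrite permK.
rewrite next_K // => e.
have clK v : v \in K :&: L -> s v \in K :&: L.
  by rewrite !inE => /andP[vK vL]; rewrite perm_closed // vK /= sr // perm_closed.
have wZ : w \in K :&: L by rewrite inE wL -e perm_closed // uK.
have imZ : s @: (K :&: L) = K :&: L.
  apply/eqP; rewrite eqEcard card_imset ?leqnn ?andbT; last exact: perm_inj.
  by apply/subsetP => _ /imsetP[v vZ ->]; exact: clK.
have : w \in s @: (K :&: L) by rewrite imZ.
case/imsetP => v; rewrite inE => /andP[vK vL]; rewrite -e => /perm_inj ->.
by rewrite sr // permK.
Qed.

Lemma forced_of_placements (g : {ffun sP -> E}) (j i : {ffun E -> V}) :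
  injective g -> j \in placements g K id -> i \in placements g L next_vertex ->
  [&& surjectiveb j, surjectiveb i, forced_arcs j i K s &
      forced_arcs i j L r^-1%g].
Proof.
move=> gI /(placementsP _ _ gI (subsetUl _ _))[j1 j2 j3].
move=> /(placementsP _ _ gI (subsetUr _ _))[i1 i2 i3].
apply/and4P; split.
- apply/forallP => v; apply/existsP; case: (boolP (v \in P)) => vP.
    by exists (g (mkP vP)); rewrite j1.
  by have [t _ /eqP jt] := j3 v vP; exists t.
- apply/forallP => v; apply/existsP; case: (boolP (v \in P)) => vP.
    have vP' : (if v \in L then r^-1%g v else s^-1%g v) \in P.
      rewrite inE; move: vP; rewrite inE; case: ifP => vL.
        by rewrite rV vL !orbT.
      by rewrite sV => /orP[->|].
    exists (g (mkP vP')); rewrite i1 /=; case: ifP => vL.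
      by rewrite next_L ?permKV // rV.
    rewrite next_K ?permKV // sV; by move: vP; rewrite inE vL orbF.
  by have [t _ /eqP it] := i3 v vP; exists t.
- apply/forced_arcsP => v vK; have vP : v \in P by rewrite inE vK.
  exists (g (mkP vP)); split; last by rewrite i1 next_K.
  move=> t; apply/eqP/eqP => [jt|->]; last by rewrite j1.
  have [|w tw] := j2 t; first by rewrite jt.
  by move: jt; rewrite tw j1 /= => jt; congr (g _); apply: val_inj.
apply/forced_arcsP => w wL; have vP : r^-1%g w \in P by rewrite inE rV wL orbT.
exists (g (mkP vP)); split; last by rewrite j1.
move=> t; apply/eqP/eqP => [it|->]; last by rewrite i1 next_L ?rV // permKV.
have [|u tu] := i2 t; first by rewrite it.
move: it; rewrite tu i1 => it; congr (g _); apply: val_inj => /=.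
by apply: next_inv it => //; exact: valP.
Qed.

(** [g] takes [v] to the arc alone in leaving [v] if [v] is in [K], and otherwise to the arc alone
    in entering [r v]. *)
Lemma placements_of_forced (j i : {ffun E -> V}) :
  [&& surjectiveb j, surjectiveb i, forced_arcs j i K s &
      forced_arcs i j L r^-1%g] ->
  exists g : {ffun sP -> E}, [/\ injective g, j \in placements g K id &
    i \in placements g L next_vertex].
Proof.
case/and4P => /forallP sj /forallP si /forced_arcsP fK /forced_arcsP fL.
have arc (v : sP) : {t | if val v \in K then j t == val v else i t == r (val v)}.
  case: (boolP (val v \in K)) => vK; apply: sigW; exact/existsP.
pose g : {ffun sP -> E} := [ffun v => sval (arc v)].
have jg v : j (g v) = val v.
  rewrite ffunE; case: (arc v) => t /=; case: ifP => vK /eqP //.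
  have vL : val v \in L by have := valP v; rewrite inE vK.
  have [|u [h1 h2]] := fL (r (val v)); first by rewrite perm_closed.
  by move/eqP; rewrite h1 => /eqP ->; rewrite h2 permK.
have ig v : i (g v) = next_vertex (val v).
  have := jg v; rewrite ffunE; case: (arc v) => t /=.
  rewrite /next_vertex; case: ifP => vK /eqP // _.
  have [u [h1 h2]] := fK _ vK; by move/eqP; rewrite h1 => /eqP ->.
have gI : injective g by move=> u v /(congr1 j); rewrite !jg; exact: val_inj.
exists g; split=> //.
  apply/placementsP => //; first exact: subsetUl.
  split=> // [t jK|u uP].
    have [w [h1 h2]] := fK _ jK.
    have tP : j t \in P by rewrite inE jK.
    exists (mkP tP).
    have : t == w by rewrite -h1.
    have : g (mkP tP) == w by rewrite -h1 jg.
    by move=> /eqP -> /eqP.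
  have /existsP[t /eqP jt] := sj u; exists t => // v.
  by apply: contraNneq uP => tv; rewrite -jt tv jg; exact: valP.
apply/placementsP => //; first exact: subsetUr.
split=> // [t iL|u uP].
  have [w [h1 h2]] := fL _ iL.
  have tP : r^-1%g (i t) \in P by rewrite inE rV iL orbT.
  exists (mkP tP).
  have : t == w by rewrite -h1.
  have : g (mkP tP) == w by rewrite -h1 ig /= next_L ?rV // permKV.
  by move=> /eqP -> /eqP.
have /existsP[t /eqP it] := si u; exists t => // v.
apply: contraNneq uP => tv; rewrite -it tv ig /next_vertex inE.
have := valP v; rewrite inE; case: ifP => [vK _|vK /= vL].
  by rewrite perm_closed // vK.
by rewrite (perm_closed _ Lr) (vL : val v \in L) orbT.
Qed.

Lemma placements_unique (g g' : {ffun sP -> E}) (j i : {ffun E -> V}) :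
  injective g -> j \in placements g K id -> i \in placements g L next_vertex ->
  injective g' -> j \in placements g' K id ->
  i \in placements g' L next_vertex -> g = g'.
Proof.
move=> gI /(placementsP _ _ gI (subsetUl _ _))[j1 j2 j3].
move=> /(placementsP _ _ gI (subsetUr _ _))[i1 i2 i3].
move=> gI' /(placementsP _ _ gI' (subsetUl _ _))[j1' j2' j3'].
move=> /(placementsP _ _ gI' (subsetUr _ _))[i1' i2' i3'].
apply/ffunP => v.
suff [w gw] : exists w, g v = g' w.
  have := j1 v; rewrite gw j1' => /val_inj e; by rewrite e.
have := valP v; rewrite inE => /orP[vK|vL].
  by apply: j2'; rewrite j1.
by apply: i2'; rewrite i1 next_L // perm_closed.
Qed.

End Compatible.

Lemma compatible_of_forced (j i : {ffun E -> V}) :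
  forced_arcs j i K s -> forced_arcs i j L r^-1%g ->
  forall v, v \in K -> v \in L -> s v = r v.
Proof.
move=> /forced_arcsP fK /forced_arcsP fL v vK vL.
have [t [h1 h2]] := fK v vK.
have [|u [h3 h4]] := fL (r v); first by rewrite perm_closed.
move: h4; rewrite permK => /eqP; rewrite h1 => /eqP ut.
by rewrite -h2 -ut; apply/eqP; rewrite h3.
Qed.

(** When [s] and [r] agree, a counted pair determines its reserved arcs, whose injective placement
    gives the falling factorial. The tails of the other arcs avoid [K] and their heads avoid [L],
    independently, so that [L :\: K] and [K :\: L] are the optional targets. *)
Lemma card_forced :
  #|[set p : {ffun E -> V} * {ffun E -> V} |
      [&& surjectiveb p.1, surjectiveb p.2, forced_arcs p.1 p.2 K s &
          forced_arcs p.2 p.1 L r^-1%g]]| =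
  [forall v in K :&: L, s v == r v] *
  (#|E| ^_ #|P| * cov (#|E| - #|P|) (#|V| - #|P|) #|L :\: K| *
   cov (#|E| - #|P|) (#|V| - #|P|) #|K :\: L|).
Proof.
case: (boolP [forall v in _, _]) => [/forall_inP sr|nsr]; last first.
  rewrite mul0n; apply/eqP; rewrite cards_eq0; apply: contraNT nsr.
  case/set0Pn => -[j i]; rewrite inE => /and4P[_ _ /= fK fL].
  apply/forall_inP => v; rewrite inE => /andP[vK vL]; apply/eqP.
  exact: compatible_of_forced fK fL _ vK vL.
have {}sr v : v \in K -> v \in L -> s v = r v.
  by move=> vK vL; apply/eqP/sr; rewrite inE vK.
have PK : P :\: K = L :\: K by rewrite setDUl setDv set0U.
have PL : P :\: L = K :\: L by rewrite setDUl setDv setU0.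
rewrite mul1n -(card_sig (mem P)) -card_inj_ffuns card_sig -mulnA -sum_nat_const.
pose J g := finset.setX (placements g K id) (placements g L next_vertex).
transitivity (\sum_(g : {ffun sP -> E} | injectiveb g) #|J g|); last first.
  apply: eq_big => [g|g /injectiveP gI]; first by rewrite inE.
  by rewrite cardsX !card_placements // PK PL.
rewrite -sum1_card.
under [RHS]eq_bigr => g _ do rewrite -sum1_card big_mkcond /=.
rewrite [RHS]exchange_big /= big_mkcond /=; apply: eq_bigr => -[j i] _.
case: ifPn => [|nS].
  rewrite inE => /(placements_of_forced sr)[g [gI gj gi]].
  rewrite (bigD1 g) /=; last exact/injectiveP.
  rewrite inE /= gj gi big1 //= => g' /andP[/injectiveP gI' ne].
  rewrite inE /=; case: andP => // -[gj' gi'].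
  by rewrite (placements_unique sr gI' gj' gi' gI gj gi) eqxx in ne.
rewrite big1 // => g /injectiveP gI; rewrite inE /=; case: andP => // -[gj gi].
by move: nS; rewrite inE (forced_of_placements sr gI gj gi).
Qed.

End CountForced.

(** * Signed sums over pairs of partial permutations *)

Section CompatiblePermutations.
Variables (V : finType) (F : numFieldType).
Implicit Types (K L : {set V}) (s r : {perm V}).

Definition agree K L s r := [forall v in K :&: L, s v == r v].

(** [s] permutes the intersection, so if it moved a point of [K :\: L], the image would be a second
    point of that set. *)
Lemma perm_onI K L s : perm_on K s ->
  (forall v, v \in K :&: L -> s v \in K :&: L) -> #|K :\: L| <= 1 ->
  perm_on (K :&: L) s.
Proof.
move=> Ks clK KL; apply/subsetP => v; rewrite inE => sv.
have vK : v \in K by apply: contraNT sv => vK; rewrite (out_perm Ks).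
rewrite inE vK /=; apply: contraNT sv => vL.
have imZ : s @: (K :&: L) = K :&: L.
  apply/eqP; rewrite eqEcard card_imset ?leqnn ?andbT; last exact: perm_inj.
  by apply/subsetP => _ /imsetP[u uZ ->]; exact: clK.
have svL : s v \notin L.
  apply: contraNN vL => svL.
  have : s v \in s @: (K :&: L) by rewrite imZ inE perm_closed // vK.
  by case/imsetP => u; rewrite inE => /andP[_ uL] /perm_inj ->.
apply/eqP/(card_le1_eqP KL); rewrite !inE.
  by rewrite vL.
by rewrite svL perm_closed.
Qed.

Lemma agreeC K L s r : agree K L s r = agree L K r s.
Proof. by apply: eq_forallb => v; rewrite finset.setIC eq_sym. Qed.

Lemma agree_perm K L s r : perm_on K s -> perm_on L r -> agree K L s r ->
  #|K :\: L| <= 1 -> #|L :\: K| <= 1 -> s = r /\ perm_on (K :&: L) s.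
Proof.
move=> Ks Lr /forall_inP sr KL LK.
have clZ v : v \in K :&: L -> (s v \in K :&: L) && (r v \in K :&: L).
  move=> vZ; have /andP[vK vL] : (v \in K) && (v \in L) by rewrite inE in vZ.
  by rewrite (eqP (sr v vZ)) andbb inE (perm_closed _ Lr) vL andbT
    -(eqP (sr v vZ)) (perm_closed _ Ks).
have Zs : perm_on (K :&: L) s by apply: perm_onI => // v /clZ/andP[].
have Zr : perm_on (K :&: L) r.
  by rewrite finset.setIC; apply: perm_onI => // v; rewrite finset.setIC => /clZ/andP[].
split=> //; apply/permP => v; case: (boolP (v \in K :&: L)) => [/sr/eqP //|vZ].
by rewrite (out_perm Zs) // (out_perm Zr).
Qed.

Local Open Scope ring_scope.

(* Composition with a transposition of two points of K outside L reverses the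
   sign and preserves the agreement. *)
Lemma sum_sign_agree_eq0 K L r : (1 < #|K :\: L|)%N ->
  \sum_(s | perm_on K s) (-1) ^+ s * (agree K L s r)%:R = 0 :> F.
Proof.
case/card_gt1P => a [b [aKL bKL ab]].
have tK : perm_on K (tperm a b).
  apply/subsetP => v; rewrite inE => /eqP.
  case: tpermP => // -> _; by [case/setDP: aKL | case/setDP: bKL].
set S := \sum_(_ | _) _; apply/eqP; rewrite -eqNr; apply/eqP.
rewrite {2}/S (reindex_inj (mulgI (tperm a b))) /= -sumrN.
apply: eq_big => [s|s Ks].
  apply/idP/idP => [Ks|/(perm_onM tK)]; first exact: perm_onM.
  by rewrite mulgA tperm2 mul1g.
rewrite odd_permM odd_tperm ab /= -mulNr; congr (_ * _%:R).
  by case: (odd_perm s); rewrite ?expr0 ?expr1 ?opprK.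
congr (nat_of_bool _).
apply: eq_forallb => v; rewrite permM; case: (boolP (v \in _)) => //.
rewrite inE => /andP[vK vL]; rewrite tpermD //.
  by apply: contraTneq vL => <-; move: aKL; rewrite inE => /andP[].
by apply: contraTneq vL => <-; move: bKL; rewrite inE => /andP[].
Qed.

(** If a difference has two elements, a transposition cancels everything. Otherwise agreement forces
    [s = r] with support in the intersection, and every surviving pair has sign 1. *)
Lemma sum_sign_agree K L :
  \sum_(s | perm_on K s) \sum_(r | perm_on L r)
    (-1) ^+ s * (-1) ^+ r * (agree K L s r)%:R =
  if (#|K :\: L| <= 1)%N && (#|L :\: K| <= 1)%N then (#|K :&: L|`!)%:R else 0 :> F.
Proof.
case: leqP => KL /=; last first.
  rewrite exchange_big /= big1 // => r _.
  under eq_bigr => s _ do rewrite mulrAC.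
  by rewrite -mulr_suml sum_sign_agree_eq0 // mul0r.
case: leqP => LK; last first.
  rewrite big1 // => s _.
  under eq_bigr => r _ do rewrite -mulrA agreeC.
  by rewrite -mulr_sumr sum_sign_agree_eq0 // mulr0.
rewrite -card_perm -sum1_card natr_sum big_mkcond [RHS]big_mkcond /=.
apply: eq_bigr => s _; case: (boolP (perm_on _ s)) => Ks; last first.
  case: ifPn => // Zs; case/negP: Ks; apply: fintype.subset_trans Zs _.
  exact: subsetIl.
case: ifPn => Zs; last first.
  rewrite big1 // => r Lr; case: (boolP (agree K L s r)); rewrite ?mulr0 //.
  by move=> /(agree_perm Ks Lr)/(_ KL LK)[_ Zs']; case/negP: Zs.
rewrite (bigD1 s) /=; last by apply: fintype.subset_trans Zs _; exact: subsetIr.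
have -> : agree K L s s by apply/forall_inP.
rewrite -signr_addb addbb mul1r big1 ?addr0 // => r /andP[Lr rs].
case: (boolP (agree K L s r)); rewrite ?mulr0 //.
move=> /(agree_perm Ks Lr)/(_ KL LK)[sr _]; by rewrite sr eqxx in rs.
Qed.

Lemma sum_subsets (A : {set V}) (h : nat -> F) :
  \sum_(Y : {set V} | Y \subset A) h #|Y| =
  \sum_(k < #|A|.+1) 'C(#|A|, k)%:R * h k.
Proof.
rewrite (partition_big (fun Y : {set V} => inord #|Y| : 'I_#|A|.+1) xpredT) //=.
apply: eq_bigr => k _.
have <- := cards_draws A k; rewrite -[in RHS]sum1_card natr_sum mulr_suml.
have eqk (Y : {set V}) : Y \subset A -> (inord #|Y| == k) = (#|Y| == k :> nat).
  by move=> /subset_leq_card YA; rewrite -val_eqE /= inordK.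
apply: eq_big => [Y|Y /andP[YA]]; first by rewrite inE; apply: andb_id2l => /eqk.
by rewrite eqk // mul1r => /eqP ->.
Qed.

Lemma sum_small_subsets (A : {set V}) (h : nat -> F) :
  (forall k, (1 < k)%N -> h k = 0) ->
  \sum_(Y : {set V} | Y \subset A) h #|Y| = h 0%N + #|A|%:R * h 1%N.
Proof.
move=> h0; rewrite sum_subsets big_ord_recl bin0 mul1r; congr (_ + _).
case: #|A| => [|a]; first by rewrite big_ord0 mul0r.
rewrite big_ord_recl bin1 big1 ?addr0 // => k _.
by rewrite [h _]h0 ?mulr0.
Qed.

(** Pairs correspond to triples of disjoint sets, the intersection and the two differences; the
    differences have at most one element wherever [h] is nonzero. *)
Lemma sum_pairs_of_sets (h : nat -> nat -> nat -> F) :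
  (forall t a b, (1 < a)%N || (1 < b)%N -> h t a b = 0) ->
  \sum_(K : {set V}) \sum_(L : {set V}) h #|K :&: L| #|K :\: L| #|L :\: K| =
  \sum_(t < #|V|.+1) 'C(#|V|, t)%:R *
    (h t 0%N 0%N + (#|V| - t)%:R * (h t 1%N 0%N + h t 0%N 1%N)
     + (#|V| - t)%:R * (#|V| - t).-1%:R * h t 1%N 1%N).
Proof.
move=> h0.
pose f (x : {set V} * {set V} * {set V}) := (x.1.1 :|: x.1.2, x.1.1 :|: x.2).
pose f' (x : {set V} * {set V}) := (x.1 :&: x.2, x.1 :\: x.2, x.2 :\: x.1).
pose dis (x : {set V} * {set V} * {set V}) :=
  (x.1.2 \subset ~: x.1.1) && (x.2 \subset ~: x.1.1 :\: x.1.2).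
have f'f x : (f' (f x) == x) = dis x.
  case: x => [[Z X] Y]; rewrite /f' /f /dis /=; apply/eqP/andP.
    case=> eZ eX eY; split; apply/subsetP => v vX.
      by rewrite inE -eZ !inE; move: vX; rewrite -eX !inE => /andP[/negPf ->]; rewrite andbF.
    rewrite !inE; move: vX; rewrite -eY !inE negb_or => /andP[/andP[vZ vX] _].
    by rewrite vZ vX.
  case=> /subsetP XZ /subsetP YZX; congr (_, _, _); apply/setP => v;
   have := XZ v; have := YZX v; rewrite !inE;
   case: (v \in X); case: (v \in Y); case: (v \in Z) => //= a b;
   by first [have := a isT; done | have := b isT; done].
rewrite pair_big /= (reindex_onto f f') /=; last first.
  case=> K L _; rewrite /f' /f /=; congr (_, _); apply/setP => v; rewrite !inE.
    by case: (v \in K); case: (v \in L).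
  by case: (v \in K); case: (v \in L).
transitivity (\sum_(x | dis x) h #|x.1.1| #|x.1.2| #|x.2|).
  apply: eq_big => [x|x]; first by rewrite f'f.
  by case: x => [[Z X] Y] /eqP[/= -> -> ->].
transitivity (\sum_(Z : {set V}) \sum_(X : {set V} | X \subset ~: Z)
   \sum_(Y : {set V} | Y \subset ~: Z :\: X) h #|Z| #|X| #|Y|).
  by rewrite pair_big_dep pair_big_dep /=.
pose g t a := h t a 0%N + (#|V| - t - a)%:R * h t a 1%N.
transitivity (\sum_(Z : {set V} | Z \subset [set: V])
   (g #|Z| 0%N + (#|V| - #|Z|)%:R * g #|Z| 1%N)).
  apply: eq_big => [Z|Z _]; first by rewrite finset.subsetT.
  have -> : (#|V| - #|Z|)%N = #|~: Z| by rewrite [RHS]cardsCs setCK.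
  rewrite -(sum_small_subsets (~: Z) (h := g #|Z|)); last first.
    by move=> k k1; rewrite /g !h0 ?k1 ?mulr0 ?addr0.
  apply: eq_bigr => X XZ; rewrite sum_small_subsets; last first.
    by move=> k k1; rewrite h0 // k1 orbT.
  by rewrite cardsDS // [#|~: Z|]cardsCs setCK.
rewrite (sum_subsets _ (fun t => g t 0%N + (#|V| - t)%:R * g t 1%N)) cardsT.
apply: eq_bigr => t _; rewrite /g subn0 subn1; ring.
Qed.

End CompatiblePermutations.

(** * Insertion sequences as pairs of surjections *)

Section SequenceCount.
Variables (n m : nat).
Implicit Types (G : multidigraph n) (C : {set 'I_n}).
Implicit Types (j i : {ffun 'I_m -> 'I_n}).

Definition transpose_digraph G : multidigraph n := fun v u => G u v.

Lemma is_cycle_transpose G C : is_cycle (transpose_digraph G) C = is_cycle G C.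
Proof.
suff imp G' : is_cycle G' C -> is_cycle (transpose_digraph G') C.
  by apply/idP/idP => /imp.
case/andP => C0 /existsP[c /and3P[uc /eqP defC /forall_inP arcs]].
apply/andP; split=> //; apply/existsP; exists [tuple of rev c].
have memC v : (v \in C) = (v \in val c) by have /setP/(_ v) := defC; rewrite inE.
apply/and3P; split; first by rewrite rev_uniq.
  by apply/eqP/setP => v; rewrite inE mem_rev memC.
apply/forall_inP => v vC; apply/forall_inP => u uC.
rewrite /transpose_digraph (eqP (forall_inP (arcs u uC) v vC)) next_rev //.
rewrite (can2_eq (prev_next uc) (next_prev uc)).
by rewrite [u == _]eq_sym.
Qed.

Lemma source_cycle_transpose G C :
  is_sink_cycle (transpose_digraph G) C = is_source_cycle G C.
Proof.
rewrite /is_sink_cycle /is_source_cycle is_cycle_transpose; congr (_ && _).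
apply/forall_inP/forall_inP => h v vC; apply/forall_inP => u uC.
  exact: (forall_inP (h u uC) v vC).
exact: (forall_inP (h u uC) v vC).
Qed.

Lemma nb_sink_source_eq0 G : (nb_sink_source_cycle_vertices G == 0) =
  ~~ [exists C, is_sink_cycle G C] &&
  ~~ [exists C, is_sink_cycle (transpose_digraph G) C].
Proof.
rewrite -negb_or cards_eq0; apply: negb_inj; rewrite negbK.
apply/idP/idP.
  case/set0Pn => v; rewrite inE => /existsP[C /andP[_ /orP[h|h]]]; apply/orP.
    by left; apply/existsP; exists C.
  by right; apply/existsP; exists C; rewrite source_cycle_transpose.
move=> h.
have [C hC] : exists C, is_sink_cycle G C || is_source_cycle G C.
  case/orP: h => /existsP[C hC]; exists C; rewrite ?hC //.
  by rewrite -source_cycle_transpose hC orbT.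
have [v vC] : exists v, v \in C.
  by apply/set0Pn; case/orP: hC => /andP[/andP[]].
by apply/set0Pn; exists v; rewrite inE; apply/existsP; exists C; rewrite vC.
Qed.

Definition digraph_of_ends j i : multidigraph n :=
  fun v u => #|[set t | (j t == v) && (i t == u)]|.

Lemma out_degree_ends j i v :
  out_degree (digraph_of_ends j i) v = #|[set t | j t == v]|.
Proof.
rewrite /out_degree -sum1_card (partition_big i xpredT) //=.
apply: eq_bigr => u _; rewrite /digraph_of_ends -sum1_card.
by apply: eq_bigl => t; rewrite !inE.
Qed.

Lemma transpose_ends j i v u :
  transpose_digraph (digraph_of_ends j i) v u = digraph_of_ends i j v u.
Proof. by apply: eq_card => t; rewrite !inE andbC. Qed.

Lemma in_degree_ends j i v :
  in_degree (digraph_of_ends j i) v = #|[set t | i t == v]|.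
Proof.
rewrite -(out_degree_ends i j).
by apply: eq_bigr => u _; rewrite -transpose_ends.
Qed.

Lemma forced_arcs_sink_perm j i (K : {set 'I_n}) (s : {perm 'I_n}) :
  sink_perm (digraph_of_ends j i) K s = forced_arcs j i K s.
Proof.
apply/forall_inP/forced_arcsP => h v vK.
  have /andP[] := h v vK; rewrite out_degree_ends => /cards1P[t ht].
  rewrite /digraph_of_ends => /cards1P[t' ht']; exists t.
  split=> [t''|]; first by have /setP/(_ t'') := ht; rewrite !inE.
  have /setP/(_ t') := ht'; rewrite !inE eqxx => /andP[jt' /eqP <-].
  by have /setP/(_ t') := ht; rewrite !inE jt' => /esym/eqP ->.
have [t [h1 h2]] := h v vK; rewrite out_degree_ends.
apply/andP; split; apply/cards1P; exists t; apply/setP => t'; rewrite !inE h1 //.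
by case: eqP => // ->; rewrite h2 eqxx.
Qed.

Definition ends_of (s : insertion_sequence n m) :
    {ffun 'I_m -> 'I_n} * {ffun 'I_m -> 'I_n} :=
  ([ffun t => (tnth s t).1], [ffun t => (tnth s t).2]).

Definition sequence_of (p : {ffun 'I_m -> 'I_n} * {ffun 'I_m -> 'I_n}) :
    insertion_sequence n m := [tuple (p.1 t, p.2 t) | t < m].

Lemma ends_ofK : cancel ends_of sequence_of.
Proof.
by move=> s; apply: eq_from_tnth => t; rewrite tnth_mktuple !ffunE -surjective_pairing.
Qed.

Lemma sequence_ofK : cancel sequence_of ends_of.
Proof.
by case=> j i; congr (_, _); apply/ffunP => t; rewrite ffunE tnth_mktuple.
Qed.

Lemma multidigraph_of_ends (p : {ffun 'I_m -> 'I_n} * {ffun 'I_m -> 'I_n}) v u :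
  multidigraph_of (sequence_of p) v u = digraph_of_ends p.1 p.2 v u.
Proof.
rewrite /multidigraph_of -sum1_count big_tuple /digraph_of_ends -sum1_card.
by apply: eq_bigl => t; rewrite tnth_mktuple inE.
Qed.

Lemma eq_min_degrees G G' : (forall v u, G v u = G' v u) ->
  min_degrees_ge1 G = min_degrees_ge1 G'.
Proof.
move=> GG'; apply: eq_forallb => v; congr ((_ < _) && (_ < _)).
  by apply: eq_bigr => u _; rewrite GG'.
by apply: eq_bigr => u _; rewrite GG'.
Qed.

Lemma eq_sink_cycle G G' C : (forall v u, G v u = G' v u) ->
  is_sink_cycle G C = is_sink_cycle G' C.
Proof.
move=> GG'; rewrite /is_sink_cycle /is_cycle; congr ((_ && _) && _).
  apply: eq_existsb => c; congr [&& _, _ & _].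
  apply: eq_forallb => v; congr (_ ==> _); apply: eq_forallb => u.
  by rewrite GG'.
apply: eq_forallb => v; congr (_ ==> _); apply: eq_forallb => u.
by rewrite GG'.
Qed.

Lemma min_degrees_ends j i :
  min_degrees_ge1 (digraph_of_ends j i) = surjectiveb j && surjectiveb i.
Proof.
have pos (f : {ffun 'I_m -> 'I_n}) v :
    (0 < #|[set t | f t == v]|) = [exists t, f t == v].
  apply/card_gt0P/existsP => [[t]|[t ft]]; first by rewrite inE; exists t.
  by exists t; rewrite inE.
apply/forallP/andP => [h|[/forallP hj /forallP hi] v]; last first.
  by rewrite in_degree_ends out_degree_ends !pos hj hi.
by split; apply/forallP => v; have /andP[] := h v;
  rewrite in_degree_ends out_degree_ends !pos.
Qed.

(** Exchanging [p.1] and [p.2] reverses the arcs, so the last condition excludes source cycles. *)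
Definition good_ends (p : {ffun 'I_m -> 'I_n} * {ffun 'I_m -> 'I_n}) : bool :=
  [&& surjectiveb p.1, surjectiveb p.2,
      ~~ [exists C, is_sink_cycle (digraph_of_ends p.1 p.2) C] &
      ~~ [exists C, is_sink_cycle (digraph_of_ends p.2 p.1) C]].

Lemma card_sequences_1_1 (v0 : 'I_n) : #|sequences_1_1 n m| = cov m n 0 ^ 2.
Proof.
pose S := [set f : {ffun 'I_m -> 'I_n} | surjectiveb f].
have cardS : #|S| = cov m n 0.
  have := @card_covering_ffuns 'I_m 'I_n [set: 'I_m] [set: 'I_n] set0 (fun=> v0).
  rewrite !cardsT !card_ord cards0 => <-; last first.
    by rewrite -setI_eq0 finset.setI0.
  apply: eq_card => f; rewrite !inE finset.setU0; symmetry.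
  apply/andP/forallP => [[_ /forall_inP h] v|h].
    have /existsP[t /andP[_ ft]] := h v (finset.in_setT v); by apply/existsP; exists t.
  split; first by apply/forallP => t; rewrite !inE.
  apply/forall_inP => v _; have /existsP[t ft] := h v.
  by apply/existsP; exists t; rewrite inE.
rewrite -cardS -mulnn -cardsX -(card_imset _ (can_inj sequence_ofK)).
apply: eq_card => s; rewrite inE.
rewrite -(ends_ofK s) (mem_imset _ _ (can_inj sequence_ofK)) /S !inE.
transitivity (min_degrees_ge1
  (digraph_of_ends (ends_of s).1 (ends_of s).2)); last exact: min_degrees_ends.
apply: eq_min_degrees => v u; by rewrite multidigraph_of_ends.
Qed.

Lemma card_no_cycle_sequences :
  #|[set s in sequences_1_1 n m |
     nb_sink_source_cycle_vertices (multidigraph_of s) == 0]| =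
  #|[set p | good_ends p]|.
Proof.
rewrite -(card_imset _ (can_inj sequence_ofK)).
apply: eq_card => s; rewrite !inE -(ends_ofK s).
rewrite (mem_imset _ _ (can_inj sequence_ofK)) inE.
have GG := multidigraph_of_ends (ends_of s).
rewrite nb_sink_source_eq0 /good_ends [RHS]andbA; congr (_ && (~~ _ && ~~ _)).
- rewrite -[RHS]min_degrees_ends; exact: eq_min_degrees.
- by apply: eq_existsb => C; exact: eq_sink_cycle.
- apply: eq_existsb => C; apply: eq_sink_cycle => v u.
  by rewrite -transpose_ends /transpose_digraph GG.
Qed.

Local Open Scope ring_scope.
Variable F : numFieldType.

Lemma good_ends_signed_sum p :
  (good_ends p)%:R = \sum_(K : {set 'I_n}) \sum_(L : {set 'I_n})
    \sum_(s | perm_on K s) \sum_(r | perm_on L r)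
     (-1) ^+ #|K| * (-1) ^+ #|L| * ((-1) ^+ s * (-1) ^+ r) *
     [&& surjectiveb p.1, surjectiveb p.2, forced_arcs p.1 p.2 K s &
          forced_arcs p.2 p.1 L r^-1%g]%:R :> F.
Proof.
have sgnsum j i :
    (~~ [exists C, is_sink_cycle (digraph_of_ends j i) C])%:R =
    \sum_(K : {set 'I_n}) \sum_(s | perm_on K s)
      (-1) ^+ #|K| * (-1) ^+ s * (forced_arcs j i K s)%:R :> F.
  rewrite -signed_sum_sink_perm (exchange_big_dep xpredT) //=.
  apply: eq_bigr => K _; apply: eq_bigr => s _.
  by rewrite forced_arcs_sink_perm [_ ^+ s * _]mulrC.
(* The second expansion follows the arcs backwards; inverting its permutation makes [r], like [s],
   send tails to heads. *)
have sgnsumV j i :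
    (~~ [exists C, is_sink_cycle (digraph_of_ends j i) C])%:R =
    \sum_(K : {set 'I_n}) \sum_(s | perm_on K s)
      (-1) ^+ #|K| * (-1) ^+ s * (forced_arcs j i K s^-1%g)%:R :> F.
  rewrite sgnsum; apply: eq_bigr => K _; rewrite (reindex_inj invg_inj) /=.
  apply: eq_big => [s|s _]; last by rewrite odd_permV.
  apply/idP/idP => [Ks|/perm_onV //]; by rewrite -[s]invgK perm_onV.
have andR (a b : bool) : (a && b)%:R = a%:R * b%:R :> F by rewrite -mulnb natrM.
rewrite /good_ends !andR sgnsum sgnsumV big_distrlr /= !mulr_sumr.
apply: eq_bigr => K _; rewrite !mulr_sumr; apply: eq_bigr => L _.
rewrite big_distrlr /= !mulr_sumr; apply: eq_bigr => s _.
rewrite !mulr_sumr; apply: eq_bigr => r _.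
rewrite !andR.
have AC (a b k u f l v g : F) :
    a * (b * (k * u * f * (l * v * g))) = k * l * (u * v) * (a * (b * (f * g))).
  by ring.
exact: AC.
Qed.

End SequenceCount.

(** * Exact count of the good pairs and its recurrence *)

Section CountGood.
Local Open Scope ring_scope.
Variables (n m : nat) (F : numFieldType).

(** [M] arcs and [N] vertices remain once the common vertices of [K] and [L] are removed. The three
    terms come from equal sets, from one extra vertex on one side, and from one on each side. *)
Definition core_count (M N : nat) : F :=
  (cov M N 0)%:R ^+ 2
  - 2 * N%:R * M%:R * (cov M.-1 N.-1 0)%:R * (cov M.-1 N.-1 1)%:R
  + N%:R * N.-1%:R * (M%:R * M.-1%:R) * (cov M.-2 N.-2 1)%:R ^+ 2.

(* Only the pairs (K, L) that are equal up to at most one vertex on each side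
   contribute; t is the number of common vertices, which lie on isolated cycles. *)
Lemma card_good_ends (v0 : 'I_n) :
  #|[set p : {ffun 'I_m -> 'I_n} * {ffun 'I_m -> 'I_n} | good_ends p]|%:R =
  \sum_(t < n.+1) (n ^_ t)%:R * (m ^_ t)%:R * core_count (m - t) (n - t).
Proof.
pose c (p : nat) a := cov (m - p) (n - p) a.
(* The factorial comes from [sum_sign_agree], the arc placements and the coverings from
   [card_forced]. *)
pose h (t a b : nat) : F := if (a <= 1)%N && (b <= 1)%N then
  t`!%:R * ((-1) ^+ (a + b) * (m ^_ (t + a + b) *
     c (t + a + b)%N b * c (t + a + b)%N a)%:R) else 0.
transitivity (\sum_(K : {set 'I_n}) \sum_(L : {set 'I_n})
   h #|K :&: L| #|K :\: L| #|L :\: K|).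
  rewrite -sum1_card natr_sum big_mkcond /=.
  transitivity (\sum_(p : {ffun 'I_m -> 'I_n} * {ffun 'I_m -> 'I_n})
     (good_ends p)%:R : F).
    by apply: eq_bigr => p _; rewrite inE; case: (good_ends p).
  rewrite (eq_bigr _ (fun p _ => good_ends_signed_sum F p)).
  rewrite exchange_big /=; apply: eq_bigr => K _.
  rewrite exchange_big /=; apply: eq_bigr => L _.
  rewrite exchange_big /=.
  have cardP : #|K :|: L| = (#|K :&: L| + #|K :\: L| + #|L :\: K|)%N.
    rewrite cardsU !cardsD [L :&: K]finset.setIC.
    have := subset_leq_card (subsetIl K L).
    have := subset_leq_card (subsetIr K L).
    lia.
  transitivity (\sum_(s | perm_on K s) \sum_(r | perm_on L r)
     ((-1) ^+ s * (-1) ^+ r * (agree K L s r)%:R : F) *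
     ((-1) ^+ #|K| * (-1) ^+ #|L| * (m ^_ #|K :|: L| *
     c #|K :|: L| #|L :\: K| * c #|K :|: L| #|K :\: L|)%:R)).
    apply: eq_bigr => s Ks; rewrite exchange_big /=; apply: eq_bigr => r Lr.
    rewrite -mulr_sumr.
    have := @card_forced 'I_m 'I_n v0 K L s r Ks Lr.
    rewrite !card_ord -/(c _ _) -/(c _ _) -/(agree K L s r) -sum1_card.
    rewrite big_mkcond => /(congr1 (fun x => x%:R : F)); rewrite natr_sum natrM.
    have sumE : \sum_(p : {ffun 'I_m -> 'I_n} * {ffun 'I_m -> 'I_n})
       [&& surjectiveb p.1, surjectiveb p.2, forced_arcs p.1 p.2 K s &
        forced_arcs p.2 p.1 L r^-1%g]%:R = \sum_(p : {ffun 'I_m -> 'I_n} * {ffun 'I_m -> 'I_n})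
       (if p \in [set p | [&& surjectiveb p.1, surjectiveb p.2,
          forced_arcs p.1 p.2 K s & forced_arcs p.2 p.1 L r^-1%g]]
        then 1 else 0)%N%:R :> F.
      by apply: eq_bigr => p _; rewrite inE; case: [&& _, _, _ & _].
    move=> e; rewrite sumE e.
    have AC (x y z w : F) : x * y * (z * w) = y * z * (x * w) by ring.
    exact: AC.
  under eq_bigr => s _ do rewrite -mulr_suml.
  rewrite -mulr_suml sum_sign_agree /h; case: ifP => _; last by rewrite mul0r.
  rewrite cardP; congr (_ * (_ * _)).
  rewrite -(cardsID L K) -(cardsID K L) [L :&: K]finset.setIC.
  rewrite -signr_odd -[X in _ * X]signr_odd -signr_addb -[RHS]signr_odd !oddD.
  by case: (odd _); case: (odd _); case: (odd _).
rewrite sum_pairs_of_sets; last first.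
  move=> t a b ab; rewrite /h ifF //; apply/negbTE.
  by rewrite negb_and -!ltnNge.
rewrite card_ord; apply: eq_bigr => t _.
rewrite -bin_ffact natrM /h /c /core_count !addn0 !addn1 /=.
rewrite !subnS !ffactnSr subnS !natrM.
move: (_`!)%:R ('C(_, _))%:R (m ^_ t)%:R => a1 a2 a3.
move: (n - t)%N (m - t)%N => N M.
move: (cov M N 0)%:R (cov M.-1 N.-1 0)%:R (cov M.-1 N.-1 1)%:R (cov M.-2 N.-2 1)%:R.
move: (M.-1)%:R (N.-1)%:R M%:R N%:R.
move=> b1 b2 b3 b4 b5 b6 b7 b8; ring.
Qed.

End CountGood.

Section CountRecurrence.
Local Open Scope ring_scope.
Variables (F : numFieldType).

Definition good_count (m n : nat) : F :=
  \sum_(t < n.+1) (n ^_ t)%:R * (m ^_ t)%:R * core_count F (m - t) (n - t).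

Lemma good_countS m n :
  good_count m.+1 n.+1 = core_count F m.+1 n.+1 + n.+1%:R * m.+1%:R * good_count m n.
Proof.
rewrite /good_count big_ord_recl !ffactn0 !subn0 !mul1r; congr (_ + _).
rewrite mulr_sumr; apply: eq_bigr => t _; rewrite /= /bump /= add1n !subSS.
rewrite !ffactnS /= !natrM.
move: (n ^_ t)%:R (m ^_ t)%:R (core_count _ _ _) (n.+1)%:R (m.+1)%:R => a b c d e.
ring.
Qed.

End CountRecurrence.

From mathcomp Require Import all_classical all_reals all_analysis.
Import numFieldNormedType.Exports.
Local Open Scope classical_set_scope.
Local Open Scope ring_scope.

(** * Zero-truncated Poisson functions *)

Section TruncatedPoisson.
Variable R : realType.
Implicit Types (a b c d w x y : R).

Lemma le_of_derive (f df : R -> R) a b : a <= b ->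
  (forall x, a <= x <= b -> is_derive x 1 f (df x)) ->
  (forall x, a <= x <= b -> 0 <= df x) -> f a <= f b.
Proof.
move=> ab fd df0.
have [x||c] := @MVT_segment _ f df a b ab.
- by rewrite in_itv /= => /andP[ax xb]; apply: fd; rewrite !ltW.
- apply: derivable_within_continuous => x; rewrite in_itv /= => xab.
  by have [] := fd x xab.
- rewrite in_itv /= => cab e; rewrite -subr_ge0 e mulr_ge0 ?df0 //.
  by rewrite subr_ge0.
Qed.

Lemma expR_ge_quadratic x : 0 <= x -> 1 + x + x ^+ 2 / 2 <= expR x.
Proof.
move=> x0; rewrite -subr_ge0.
pose f (t : R) := expR t - (1 + t + t ^+ 2 / 2).
have -> : 0 = f 0 by rewrite /f expR0 expr0n /= mul0r !addr0 subrr.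
apply: (@le_of_derive f (fun t => expR t - (1 + t))) => // t /andP[t0 _].
  apply: is_derive_eq.
  rewrite /GRing.scale /=; by field.
by rewrite /= subr_ge0 expR_ge1Dx.
Qed.

Lemma expR_le_pade x : 0 <= x -> expR x * (1 - x / 2) <= 1 + x / 2.
Proof.
move=> x0; rewrite -subr_ge0.
(* [g / 2] is the derivative of the difference [f] of the two sides, and [g] itself has derivative
   [expR t * t]. *)
pose g (t : R) := 1 + expR t * (t - 1).
have g0 t : 0 <= t -> 0 <= g t.
  move=> t0; have -> : 0 = g 0 by rewrite /g expR0; ring.
  apply: (@le_of_derive g (fun t => expR t * t)) => // u /andP[u0 _].
    apply: is_derive_eq.
    rewrite /GRing.scale /=; ring.
  by rewrite /= mulr_ge0 // expR_ge0.
pose f (t : R) := 1 + t / 2 - expR t * (1 - t / 2).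
have -> : 0 = f 0 by rewrite /f expR0; by field.
apply: (@le_of_derive f (fun t => g t / 2)) => // t /andP[t0 _].
  apply: is_derive_eq.
  rewrite /g /GRing.scale /=; by field.
by rewrite /= divr_ge0 // g0.
Qed.

(** This is [x <= 2 sinh(x / 2)], squared and multiplied by [expR x]. *)
Lemma expR_sinh_bound x : 0 <= x -> x ^+ 2 * expR x <= (expR x - 1) ^+ 2.
Proof.
move=> x0.
have -> : x ^+ 2 * expR x = (x * expR (x / 2)) ^+ 2.
  by rewrite exprMn; congr (_ * _); rewrite expr2 -expRD; congr expR; by field.
rewrite ler_pXn2r ?nnegrE ?mulr_ge0 ?expR_ge0 //; last first.
  by rewrite subr_ge0 -expR0 ler_expR.
rewrite -subr_ge0.
pose f (t : R) := expR t - 1 - t * expR (t / 2).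
have -> : 0 = f 0 by rewrite /f expR0; ring.
apply: (@le_of_derive f (fun t => expR (t / 2) * (expR (t / 2) - (1 + t / 2))))
  => // t /andP[t0 _].
  have -> : expR (t / 2) * (expR (t / 2) - (1 + t / 2)) =
     expR t - (expR (t / 2) + t * (2^-1 * expR (t / 2))).
    rewrite mulrBr -expRD (_ : t / 2 + t / 2 = t); last by field.
    by field.
  apply: is_derive_eq.
  rewrite /GRing.scale /=; by field.
by rewrite /= mulr_ge0 ?expR_ge0 // subr_ge0 expR_ge1Dx.
Qed.


(** For a Poisson variable of parameter [x] conditioned to be positive, [qfun x] is the probability
    of the value 1 and [zfun x] the mean. [slope] is minus the ratio of their logarithmic
    derivatives. *)
Definition qfun x := x / (expR x - 1).
Definition zfun x := x + qfun x.
Definition slope x := x / (1 - qfun x) - 1.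

Lemma expRB1_gt0 x : 0 < x -> 0 < expR x - 1.
Proof. by move=> x0; rewrite subr_gt0 -expR0 ltr_expR. Qed.

Lemma zfunE x : 0 < x -> zfun x = x * expR x / (expR x - 1).
Proof.
move=> /expRB1_gt0/lt0r_neq0 e0; rewrite /zfun /qfun; by field.
Qed.

Lemma qfun_gt0 x : 0 < x -> 0 < qfun x.
Proof. by move=> x0; rewrite divr_gt0 // expRB1_gt0. Qed.

Lemma qfun_lt1 x : 0 < x -> qfun x < 1.
Proof.
move=> x0; rewrite ltr_pdivrMr ?expRB1_gt0 // mul1r ltrBrDr addrC.
by rewrite expR_gt1Dx // gt_eqF.
Qed.

Lemma qfun_ge x : 0 < x -> 1 - x / 2 <= qfun x.
Proof.
move=> x0; rewrite ler_pdivlMr ?expRB1_gt0 //.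
have := expR_le_pade (ltW x0); lra.
Qed.

Lemma qfun_le x : 0 < x -> (x + 2) * qfun x <= 2.
Proof.
move=> x0; rewrite mulrA ler_pdivrMr ?expRB1_gt0 //.
have := expR_ge_quadratic (ltW x0); lra.
Qed.

Lemma zq_le1 x : 0 < x -> zfun x * qfun x <= 1.
Proof.
move=> x0; have e0 := expRB1_gt0 x0; have ne0 := lt0r_neq0 e0.
rewrite zfunE // (_ : _ * _ = x ^+ 2 * expR x / (expR x - 1) ^+ 2); last first.
  by rewrite /qfun; field.
rewrite ler_pdivrMr ?exprn_gt0 // mul1r; exact: expR_sinh_bound (ltW x0).
Qed.

Lemma zfun_gt1 x : 0 < x -> 1 < zfun x.
Proof. move=> x0; have := qfun_ge x0; rewrite /zfun; lra. Qed.

Lemma slopeE x : 0 < x -> slope x = (zfun x - 1) / (1 - qfun x).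
Proof.
move=> x0; have := qfun_lt1 x0; rewrite -subr_gt0 => /lt0r_neq0 q1.
rewrite /slope /zfun; by field.
Qed.

Lemma slope_ge1 x : 0 < x -> 1 <= slope x.
Proof.
move=> x0; have q1 : 0 < 1 - qfun x by rewrite subr_gt0 qfun_lt1.
rewrite /slope lerBrDr ler_pdivlMr //; have := qfun_ge x0; lra.
Qed.

Lemma is_derive_qfun x : 0 < x ->
  is_derive x 1 qfun (qfun x * (1 - zfun x) / x).
Proof.
move=> x0; have e0 := lt0r_neq0 (expRB1_gt0 x0).
have h : is_derive x 1 (fun t => (expR t - 1)^-1) (- (expR x - 1) ^- 2 *: expR x).
  apply: is_deriveV => //; apply: is_derive_eq; ring.
rewrite /qfun; apply: is_derive_eq.
rewrite zfunE // /GRing.scale /=; field; by rewrite e0 gt_eqF.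
Qed.

Lemma is_derive_zfun x : 0 < x ->
  is_derive x 1 zfun (zfun x * (1 - qfun x) / x).
Proof.
move=> x0; have h := is_derive_qfun x0; apply: is_derive_eq.
rewrite /zfun; field; by rewrite gt_eqF.
Qed.

Lemma is_derive_slope x : 0 < x ->
  is_derive x 1 slope ((1 - qfun x * zfun x) / (1 - qfun x) ^+ 2).
Proof.
move=> x0; have h := is_derive_qfun x0.
have q1 : 1 - qfun x != 0 by rewrite subr_eq0 gt_eqF // qfun_lt1.
have h2 : is_derive x 1 (fun t => (1 - qfun t)^-1)
    (- (1 - qfun x) ^- 2 *: (- (qfun x * (1 - zfun x) / x))).
  apply: is_deriveV => //; apply: is_derive_eq; ring.
apply: is_derive_eq.
rewrite /GRing.scale /= /zfun; field; by rewrite q1 gt_eqF.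
Qed.

(** The derivative of [zfun] is at least 1/2: by [zq_le1] it is at least [(zfun t - 1) / t], to
    which [qfun_ge] applies. *)
Lemma le_zfun2 x y : 0 < x -> x <= y -> y - x <= 2 * (zfun y - zfun x).
Proof.
move=> x0 xy; suff : 2 * zfun x - x <= 2 * zfun y - y by lra.
apply: (@le_of_derive (fun t => 2 * zfun t - t)
  (fun t => 2 * (zfun t * (1 - qfun t) / t) - 1) _ _ xy) => t /andP[xt _];
  have t0 : 0 < t by exact: lt_le_trans xt.
  have h := is_derive_zfun t0; apply: is_derive_eq.
  by rewrite /GRing.scale /=; ring.
rewrite /= subr_ge0 mulrA ler_pdivlMr // mul1r.
have := zq_le1 t0; have := qfun_ge t0; rewrite /zfun; lra.
Qed.

Lemma ltr_zfun x y : 0 < x -> x < y -> zfun x < zfun y.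
Proof. by move=> x0 xy; have := le_zfun2 x0 (ltW xy); lra. Qed.

Lemma ler_zfun_inv x y : 0 < x -> 0 < y -> zfun x <= zfun y -> x <= y.
Proof.
move=> x0 y0; apply: contraTT; rewrite -!ltNge; exact: ltr_zfun.
Qed.

Lemma qfun_decr x y : 0 < x -> x <= y -> qfun y <= qfun x.
Proof.
move=> x0 xy; suff : - qfun x <= - qfun y by lra.
apply: (@le_of_derive (fun t => - qfun t)
  (fun t => - (qfun t * (1 - zfun t) / t)) _ _ xy) => t /andP[xt _];
  have t0 : 0 < t by exact: lt_le_trans xt.
  by have h := is_derive_qfun t0; apply: is_derive_eq.
rewrite /= -mulNr -mulrN opprB divr_ge0 ?ltW // mulr_gt0 ?qfun_gt0 //.
by rewrite subr_gt0 zfun_gt1.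
Qed.

Lemma qfun_lipschitz x y : 0 < x -> x <= y -> qfun x - qfun y <= (y - x) / 2.
Proof. move=> x0 xy; have := le_zfun2 x0 xy; rewrite /zfun; lra. Qed.

Lemma slope_incr x y : 0 < x -> x <= y -> slope x <= slope y.
Proof.
move=> x0 xy; apply: (@le_of_derive slope
  (fun t => (1 - qfun t * zfun t) / (1 - qfun t) ^+ 2)) => // t /andP[xt _];
  have t0 : 0 < t by exact: lt_le_trans xt.
  exact: is_derive_slope.
by rewrite /= divr_ge0 ?sqr_ge0 // subr_ge0 mulrC zq_le1.
Qed.

(** The derivative of [slope] is at most 1 once [zfun t + qfun t >= 2], which is [qfun_ge]. *)
Lemma slope_lipschitz x y : 0 < x -> x <= y -> slope y - slope x <= y - x.
Proof.
move=> x0 xy; suff : x - slope x <= y - slope y by lra.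
apply: (@le_of_derive (fun t => t - slope t)
  (fun t => 1 - (1 - qfun t * zfun t) / (1 - qfun t) ^+ 2) _ _ xy) => t /andP[xt _];
  have t0 : 0 < t by exact: lt_le_trans xt.
  by have h := is_derive_slope t0; apply: is_derive_eq.
have q1 : 0 < 1 - qfun t by rewrite subr_gt0 qfun_lt1.
rewrite /= subr_ge0 ler_pdivrMr ?exprn_gt0 // mul1r.
have := qfun_ge t0; have := qfun_gt0 t0; rewrite /zfun; nra.
Qed.

(* Cauchy's mean value theorem for ln q against ln z: the ratio of the
   derivatives is - slope, which is monotone. *)
Lemma ln_qfun_bounds w x : 0 < w -> w <= x ->
  slope w * (ln (zfun x) - ln (zfun w)) <= ln (qfun w) - ln (qfun x)
    <= slope x * (ln (zfun x) - ln (zfun w)).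
Proof.
move=> w0 wx.
have dlnq (t : R) : 0 < t -> is_derive t 1 (fun u => ln (qfun u)) ((1 - zfun t) / t).
  move=> t0; have h1 := is_derive1_ln (qfun_gt0 t0).
  have h2 := is_derive1_comp h1 (is_derive_qfun t0).
  apply: is_derive_eq; field; by rewrite !gt_eqF ?qfun_gt0.
have dlnz (t : R) : 0 < t -> is_derive t 1 (fun u => ln (zfun u)) ((1 - qfun t) / t).
  move=> t0; have z0 : 0 < zfun t by exact: lt_trans (zfun_gt1 t0).
  have h1 := is_derive1_ln z0.
  have h2 := is_derive1_comp h1 (is_derive_zfun t0).
  apply: is_derive_eq; field; by rewrite !gt_eqF.
have dE (t : R) : 0 < t -> zfun t - 1 = slope t * (1 - qfun t).
  by move=> t0; rewrite slopeE // divfK // subr_eq0 gt_eqF // qfun_lt1.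
apply/andP; split.
  suff : - ln (qfun w) - slope w * ln (zfun w) <=
         - ln (qfun x) - slope w * ln (zfun x) by lra.
  apply: (@le_of_derive (fun t => - ln (qfun t) - slope w * ln (zfun t))
   (fun t => - ((1 - zfun t) / t) - slope w * ((1 - qfun t) / t))) => // t /andP[xt _];
  have t0 : 0 < t by exact: lt_le_trans xt.
    have h1 := dlnq t t0; have h2 := dlnz t t0; apply: is_derive_eq.
    by rewrite /GRing.scale /=; ring.
  rewrite /= (_ : _ - _ = (slope t - slope w) * (1 - qfun t) / t); last first.
    by rewrite -mulNr opprB dE //; field; rewrite gt_eqF.
  apply: divr_ge0 (ltW t0); apply: mulr_ge0; rewrite subr_ge0 ?slope_incr //.
  by rewrite ltW // qfun_lt1.
suff : ln (qfun w) + slope x * ln (zfun w) <=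
       ln (qfun x) + slope x * ln (zfun x) by lra.
apply: (@le_of_derive (fun t => ln (qfun t) + slope x * ln (zfun t))
   (fun t => (1 - zfun t) / t + slope x * ((1 - qfun t) / t))) => // t /andP[wt tx];
  have t0 : 0 < t by exact: lt_le_trans wt.
  have h1 := dlnq t t0; have h2 := dlnz t t0; apply: is_derive_eq.
  by rewrite /GRing.scale /=; ring.
rewrite /= (_ : _ + _ = (slope x - slope t) * (1 - qfun t) / t); last first.
  by rewrite -[1 - zfun t]opprB dE //; field; rewrite gt_eqF.
apply: divr_ge0 (ltW t0); apply: mulr_ge0; rewrite subr_ge0 ?slope_incr //.
  by rewrite ltW // qfun_lt1.
Qed.

(** The ratio of the derivatives of [ln] and [L] is again [slope]. [L] is chosen so that its
    increment in [lnLyx] equals the increment [l] of [ln (zfun _)] in [lnzxw]. *)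
Lemma ln_bounds x y : 0 < x -> x <= y ->
  let L t := ln (zfun t - 1) - ln (zfun t) in
  slope x * (L y - L x) <= ln y - ln x <= slope y * (L y - L x).
Proof.
move=> x0 xy; set L := fun t : R => ln (zfun t - 1) - ln (zfun t); rewrite /=.
have dL (t : R) : 0 < t -> is_derive t 1 L ((1 - qfun t) / (t * (zfun t - 1))).
  move=> t0; have z1 := zfun_gt1 t0.
  have z0 : 0 < zfun t by exact: lt_trans z1.
  have z10 : 0 < zfun t - 1 by rewrite subr_gt0.
  have h1 := is_derive1_ln z0.
  have h2 := is_derive1_comp h1 (is_derive_zfun t0).
  have h3 := is_derive1_ln z10.
  have h4 : is_derive t 1 (fun u => zfun u - 1) (zfun t * (1 - qfun t) / t).
    by have h5 := is_derive_zfun t0; apply: is_derive_eq; rewrite subr0.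
  have h6 := @is_derive1_comp R (@ln R) (fun u => zfun u - 1) t _ _ h3 h4.
  rewrite /L; apply: is_derive_eq; field; by rewrite !gt_eqF.
have dE (t : R) : 0 < t -> t^-1 = slope t * ((1 - qfun t) / (t * (zfun t - 1))).
  move=> t0; rewrite slopeE //; field.
  by rewrite !gt_eqF ?subr_gt0 ?qfun_lt1 ?zfun_gt1.
have pos (t : R) : 0 < t -> 0 <= (1 - qfun t) / (t * (zfun t - 1)).
  move=> t0; rewrite divr_ge0 // ?mulr_ge0 // ?subr_ge0 ltW //;
    by rewrite ?qfun_lt1 // ?zfun_gt1.
apply/andP; split.
  suff : ln x - slope x * L x <= ln y - slope x * L y by lra.
  apply: (@le_of_derive (fun t => ln t - slope x * L t)
   (fun t => t^-1 - slope x * ((1 - qfun t) / (t * (zfun t - 1)))) _ _ xy) => t /andP[xt _];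
  have t0 : 0 < t by exact: lt_le_trans xt.
    have h1 := is_derive1_ln t0; have h2 := dL t t0; apply: is_derive_eq.
    by rewrite /GRing.scale /=; ring.
  by rewrite /= (dE t t0) -mulrBl mulr_ge0 ?pos // subr_ge0 slope_incr.
suff : slope y * L x - ln x <= slope y * L y - ln y by lra.
apply: (@le_of_derive (fun t => slope y * L t - ln t)
   (fun t => slope y * ((1 - qfun t) / (t * (zfun t - 1))) - t^-1) _ _ xy) => t /andP[xt ty];
  have t0 : 0 < t by exact: lt_le_trans xt.
  have h1 := is_derive1_ln t0; have h2 := dL t t0; apply: is_derive_eq.
  by rewrite /GRing.scale /=; ring.
by rewrite /= (dE t t0) -mulrBl mulr_ge0 ?pos // subr_ge0 slope_incr.
Qed.

Lemma zfun_surj c : 1 < c -> exists2 x, 0 < x & zfun x = c.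
Proof.
move=> c1.
(* A positive zero of [h] solves the equation; starting the interval at [c - 1] discards the trivial
   zero at 0. *)
pose h (t : R) := t * expR t - c * (expR t - 1).
have hc : {within `[c - 1, c], continuous h}.
  apply: derivable_within_continuous => t _; rewrite /h; exact: ex_derive.
have h1 : h (c - 1) <= 0.
  have := expR_ge1Dx (c - 1); rewrite /h; lra.
have h2 : 0 <= h c by rewrite /h; lra.
have cc : c - 1 <= c by lra.
have [|x xc hx] := @IVT _ h (c - 1) c 0 cc hc.
  by rewrite ge_min h1 /= le_max h2 orbT.
have x0 : 0 < x by move: xc; rewrite in_itv /= => /andP[+ _]; lra.
exists x => //; rewrite zfunE //.
apply: (mulIf (lt0r_neq0 (expRB1_gt0 x0))).
rewrite divfK ?lt0r_neq0 ?expRB1_gt0 //; move: hx; rewrite /h; lra.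
Qed.

End TruncatedPoisson.

(** * Ratios of numbers of surjections *)

Section SurjectionRatio.
Variable R : realType.
Implicit Types (M N a b t x y w : R).

Lemma ln_le_sub a b t : 0 < a -> 0 < b -> t <= ln a - ln b -> b * (1 + t) <= a.
Proof.
move=> a0 b0; rewrite -ln_div ?posrE // => tab.
rewrite -ler_pdivlMl // mulrC -[leRHS]lnK ?posrE ?divr_gt0 //.
by apply: le_trans (expR_ge1Dx _) _; rewrite ler_expR.
Qed.

Lemma ln_sub1_bounds M : 1 < M -> M^-1 <= ln M - ln (M - 1) <= (M - 1)^-1.
Proof.
move=> M1; have M0 : 0 < M by lra. have M10 : 0 < M - 1 by lra.
apply/andP; split.
  have := @le_ln1Dx R (- M^-1); rewrite ltrN2 invf_lt1 // => /(_ M1).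
  rewrite (_ : 1 + _ = (M - 1) / M); last by field; rewrite gt_eqF.
  by rewrite ln_div ?posrE //; lra.
have := @le_ln1Dx R (M - 1)^-1.
rewrite (_ : 1 + _ = M / (M - 1)); last by field; rewrite gt_eqF.
rewrite ln_div ?posrE //; apply; apply: lt_trans (_ : 0 < _); first lra.
by rewrite invr_gt0.
Qed.

(** * Comparison of the parameters at (M, N), (M - 1, N - 1) and (M - 1, N) *)

Section LocalComparison.
Variables (M N x y w : R).
Hypotheses (N1 : 1 < N) (NM : N + 1 < M) (x0 : 0 < x) (y0 : 0 < y) (w0 : 0 < w).
Hypotheses (zx : zfun x = M / N) (zy : zfun y = (M - 1) / (N - 1))
  (zw : zfun w = (M - 1) / N).

Let l := ln M - ln (M - 1).

Let wx : w <= x.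
Proof.
have N1' := N1; have NM' := NM.
by apply: ler_zfun_inv => //; rewrite zx zw ler_pM2r ?invr_gt0; lra.
Qed.

Let zyx : zfun y - zfun x = (M - N) / (N * (N - 1)).
Proof.
have N1' := N1; have NM' := NM.
by rewrite zx zy; field; rewrite !gt_eqF //; lra.
Qed.

Let xy : x <= y.
Proof.
have N1' := N1; have NM' := NM.
apply: ler_zfun_inv => //; rewrite -subr_ge0 zyx divr_ge0 ?mulr_ge0 //; lra.
Qed.

Let lnzxw : ln (zfun x) - ln (zfun w) = l.
Proof.
have N1' := N1; have NM' := NM.
by rewrite zx zw !ln_div ?posrE /l; lra.
Qed.

(** The excess [M - N] is the same at [x] and [y] and cancels: [(z - 1) / z] is [(M - N) / M] at [x]
    and [(M - N) / (M - 1)] at [y]. *)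
Let lnLyx : (ln (zfun y - 1) - ln (zfun y)) - (ln (zfun x - 1) - ln (zfun x)) = l.
Proof.
have N1' := N1; have NM' := NM.
have -> : zfun y - 1 = (M - N) / (N - 1).
  by rewrite zy; field; rewrite gt_eqF //; lra.
have -> : zfun x - 1 = (M - N) / N by rewrite zx; field; rewrite gt_eqF //; lra.
by rewrite zx zy !ln_div ?posrE /l; lra.
Qed.

Let lnq := ln_qfun_bounds w0 wx.
Let lnb := ln_bounds x0 xy.

(* Both sides are compared, through logarithms, with slope x * l. *)
Lemma qfun_cross_le : x * qfun w <= y * qfun x.
Proof.
have N1' := N1; have NM' := NM.
have := lnq; have := lnb; rewrite /= lnLyx lnzxw => /andP[h1 _] /andP[_ h2].
have qx := qfun_gt0 x0; have qw := qfun_gt0 w0.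
suff h3 : ln (x * qfun w) <= ln (y * qfun x).
  have p1 := mulr_gt0 x0 qw; have p2 := mulr_gt0 y0 qx.
  by rewrite ler_ln ?posrE in h3.
have lnM_pos (a b : R) : 0 < a -> 0 < b -> ln (a * b) = ln a + ln b.
  by move=> a0 b0; rewrite lnM ?posrE.
rewrite (lnM_pos _ _ x0 qw) (lnM_pos _ _ y0 qx); lra.
Qed.

(** This is the step of the upper bound in [sigma_bounds]. The increments [y - x] and
    [qfun w - qfun x] add up to at least [zfun x / M = 1 / N]; multiplied by [k], they pay for the
    loss in the cross product and for the growth from [k] to [k']. *)
Lemma qfun_cross_ge (k k' : R) : 2 <= N -> k = 12 / N -> k' = 12 / (N - 1) ->
  k < qfun x -> (qfun x - k) * (y + k') <= (x + k) * (qfun w - k).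
Proof.
have N1' := N1; have NM' := NM.
move=> N2 kE k'E kq.
have qx := qfun_gt0 x0; have qw := qfun_gt0 w0.
have N0 : 0 < N by lra. have N10 : 0 < N - 1 by lra. have M0 : 0 < M by lra.
have M10 : 0 < M - 1 by lra.
have /andP[l1 l2] : M^-1 <= l <= (M - 1)^-1 by apply: ln_sub1_bounds; lra.
have l0 : 0 <= l by apply: le_trans l1; rewrite invr_ge0 ltW.
have := lnq; have := lnb; rewrite /= lnLyx lnzxw => /andP[b1 b2] /andP[q1 q2].
have Dx := slope_ge1 x0; have Dw := slope_ge1 w0.
have yx : x * M^-1 <= y - x.
  have := ln_le_sub y0 x0 b1.
  have : M^-1 <= slope x * l by apply: le_trans l1 _; rewrite ler_peMl.
  move: (slope x * l) => s /(ler_wpM2l (ltW x0)); lra.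
have Qq : qfun x * M^-1 <= qfun w - qfun x.
  have := ln_le_sub qw qx q1.
  have : M^-1 <= slope w * l by apply: le_trans l1 _; rewrite ler_peMl.
  move: (slope w * l) => s /(ler_wpM2l (ltW qx)); lra.
(* The variation of [slope] times [l] bounds the gap between the two sides of [qfun_cross_le] on the
   logarithmic scale; it is of second order. *)
have yw : (slope y - slope w) * l <= 2 / (N * (N - 1)).
  have d1 : slope y - slope w <= 2 * (M - 1) / (N * (N - 1)).
    have h1 := slope_lipschitz w0 (le_trans wx xy).
    have h2 := le_zfun2 w0 (le_trans wx xy).
    have h3 : zfun y - zfun w = (M - 1) / (N * (N - 1)).
      by rewrite zy zw; field; rewrite !gt_eqF.
    rewrite h3 in h2; lra.
  have -> : 2 / (N * (N - 1)) = 2 * (M - 1) / (N * (N - 1)) * (M - 1)^-1.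
    by field; rewrite !gt_eqF.
  apply: ler_pM => //.
  by rewrite subr_ge0 slope_incr // (le_trans wx).
have y3 : y <= 3 * x.
  have h1 := le_zfun2 x0 xy; rewrite zyx in h1.
  have h2 : (M - N) / (N * (N - 1)) = (zfun x - 1) / (N - 1).
    by rewrite zx; field; rewrite !gt_eqF.
  have h3 : zfun x - 1 <= x by have := qfun_lt1 x0; rewrite /zfun; lra.
  have h4 : (zfun x - 1) / (N - 1) <= zfun x - 1.
    have z1 : 0 < zfun x - 1 by rewrite subr_gt0 zfun_gt1.
    by rewrite ler_pdivrMr // ler_peMr ?(ltW z1) //; lra.
  by rewrite h2 in h1; lra.
have cross : - (6 * qfun x * x / (N * (N - 1))) <= x * qfun w - qfun x * y.
  have h : - (2 / (N * (N - 1))) <= ln (x * qfun w) - ln (qfun x * y).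
    have lnM_pos (a b : R) : 0 < a -> 0 < b -> ln (a * b) = ln a + ln b.
      by move=> a0 b0; rewrite lnM ?posrE.
    rewrite (lnM_pos _ _ x0 qw) (lnM_pos _ _ qx y0); lra.
  have := ln_le_sub (mulr_gt0 x0 qw) (mulr_gt0 qx y0) h.
  have NN : 0 < N * (N - 1) by rewrite mulr_gt0.
  have e0 : 0 <= 2 / (N * (N - 1)) by rewrite divr_ge0 // ltW.
  have -> : 6 * qfun x * x / (N * (N - 1)) = 3 * (qfun x * x * (2 / (N * (N - 1)))).
    by field; rewrite !gt_eqF.
  have : qfun x * y * (2 / (N * (N - 1))) <= 3 * (qfun x * x * (2 / (N * (N - 1)))).
    have : qfun x * y <= 3 * (qfun x * x) by nra.
    by move=> /(ler_wpM2r e0); move: (2 / (N * (N - 1))) => e; lra.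
  move: (2 / (N * (N - 1))) => e; lra.
have k0 : 0 < k by rewrite kE divr_gt0.
have k'k : k' - k = k / (N - 1) by rewrite kE k'E; field; rewrite !gt_eqF.
(* The cross loss [6 q x / (N (N - 1))], where 6 is 2 from [yw] times 3 from [y3], is
   [k q x / 2 / (N - 1)] for [k = 12 / N]; then [qfun_le] bounds [q + q x / 2] by 1. *)
have main : qfun x / (N - 1) + qfun x * x / 2 / (N - 1)
    <= (x + qfun x) * M^-1 + k / (N - 1).
  have -> : (x + qfun x) * M^-1 = N^-1 by rewrite -/(zfun x) zx; field; rewrite !gt_eqF.
  have qx2 := qfun_le x0.
  rewrite -mulrDl -subr_ge0.
  have -> : N^-1 + k / (N - 1) - (qfun x + qfun x * x / 2) / (N - 1) =
    (1 - (x + 2) * qfun x / 2 + 11 / N) / (N - 1).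
    by rewrite kE; field; rewrite !gt_eqF.
  have N11 : 0 <= 11 / N by rewrite divr_ge0 // ltW.
  by apply: divr_ge0 (ltW N10); lra.
have -> : (x + k) * (qfun w - k) = (qfun x - k) * (y + k') +
   ((x * qfun w - qfun x * y) + k * (qfun w - qfun x) + k * (y - x)
    - qfun x * (k' - k) + k * (k' - k)) by ring.
rewrite lerDl k'k.
have : k * (qfun x / (N - 1) + qfun x * x / 2 / (N - 1)) <=
       k * ((x + qfun x) * M^-1 + k / (N - 1)) by rewrite ler_pM2l.
have -> : k * (qfun x / (N - 1) + qfun x * x / 2 / (N - 1)) =
  qfun x * (k / (N - 1)) + 6 * qfun x * x / (N * (N - 1)).
  by rewrite kE; field; rewrite !gt_eqF.
have : k * (qfun x * M^-1) <= k * (qfun w - qfun x) by rewrite ler_pM2l.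
have : k * (x * M^-1) <= k * (y - x) by rewrite ler_pM2l.
move: cross; rewrite !mulrDr !mulrDl; lra.
Qed.

End LocalComparison.

Lemma cov_surj_rec p c : (cov p.+1 c.+1 0 = c.+1 * (cov p c 0 + cov p c.+1 0))%N.
Proof. by rewrite /= covS mul0n addn0. Qed.

Lemma cov_gt0 p c : (0 < c <= p)%N -> (0 < cov p c 0)%N.
Proof.
elim: p c => [|p IH] [|c] //=; rewrite ltnS => cp; rewrite addn0 muln_gt0 /= covS.
case: c cp => [_|c cp]; last by rewrite addn_gt0 IH.
by case: p IH => [//|p IH]; rewrite addn_gt0 (IH 1) ?orbT.
Qed.

Lemma cov_eq0 p c : (p < c)%N -> (cov p c 0 = 0)%N.
Proof.
elim: p c => [|p IH] [|c] //=; rewrite ltnS => cp.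
by rewrite covS !IH ?muln0 // ltnW.
Qed.

Local Arguments cov : simpl never.

Definition sigma (m n : nat) : R :=
  m%:R * (cov m.-1 n 0)%:R / (cov m n 0)%:R.

(** The probability that a given vertex has a single preimage under a uniform random surjection;
    [qfun] is its Poisson counterpart. *)
Definition rho (m n : nat) : R :=
  m%:R * (cov m.-1 n.-1 0)%:R / (cov m n 0)%:R.

Let cov_pos p c : (0 < c <= p)%N -> 0 < (cov p c 0)%:R :> R.
Proof. by move=> h; rewrite ltr0n cov_gt0. Qed.

Lemma rhoD m n : (0 < n <= m)%N -> rho m n + sigma m n = m%:R / n%:R.
Proof.
case: m n => [|m] [|n] // /cov_pos; rewrite /rho /sigma cov_surj_rec natrM natrD /=.
rewrite pmulr_rgt0 ?ltr0Sn // => h; field.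
by rewrite !gt_eqF //= ltr0Sn.
Qed.

Lemma rho_gt0 m n : (1 < n <= m)%N -> 0 < rho m n.
Proof.
case: m n => [|m] [|[|n]] // /andP[_ nm].
by rewrite /rho /= divr_gt0 ?cov_pos // mulr_gt0 ?ltr0Sn // cov_pos.
Qed.

Lemma sigma_gt0 m n : (0 < n < m)%N -> 0 < sigma m n.
Proof.
case: m n => [|m] [|n] // /andP[_ nm].
by rewrite /sigma /= divr_gt0 ?cov_pos ?mulr_gt0 ?ltr0Sn ?cov_pos //= ltnW.
Qed.

(** [sigma m n] and [rho m n.+1] have the same numerator, so their quotient compares the surjections
    onto [n.+1] and onto [n] points, the two terms of [cov_surj_rec]. *)
Lemma sigma_rec m n : (0 < n < m)%N ->
  sigma m.+1 n.+1 = m.+1%:R / n.+1%:R * (sigma m n / (sigma m n + rho m n.+1)).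
Proof.
case: m n => [|m] [|n] // /andP[_ nm].
have s1 : 0 < (cov m n.+1 0)%:R :> R by apply: cov_pos.
have s2 : 0 < (cov m.+1 n.+1 0)%:R :> R by apply: cov_pos => /=; exact: ltnW.
have s3 : 0 < (cov m.+1 n.+2 0)%:R :> R by apply: cov_pos.
rewrite /sigma /rho /pred (cov_surj_rec m.+1 n.+1) natrM natrD.
move: s1 s2 s3; move: (cov m n.+1 0)%:R (cov m.+1 n.+1 0)%:R (cov m.+1 n.+2 0)%:R.
move=> a b c a0 b0 c0; have m0 : 0 < m.+1%:R :> R by rewrite ltr0Sn.
have n0 : 0 < n.+2%:R :> R by rewrite ltr0Sn.
move: m0 n0; move: m.+1%:R m.+2%:R n.+2%:R => p p' q p0 q0.
have h1 : p * a * b + p * a * c != 0 by rewrite gt_eqF // addr_gt0 ?mulr_gt0.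
field; rewrite !gt_eqF ?addr_gt0 ?mulr_gt0 //=.
Qed.

Lemma sigma_diag n : sigma n.+2 n.+1 = 2 / n.+1%:R.
Proof.
have s0 : 0 < (cov n.+2 n.+1 0)%:R :> R by apply: cov_pos => /=; exact: ltnW.
have e : (n.+1 * n.+2 * cov n.+1 n.+1 0 = 2 * cov n.+2 n.+1 0)%N.
  elim: n {s0} => [//|n IH].
  rewrite (cov_surj_rec n.+2 n.+1) (cov_surj_rec n.+1 n.+1) (@cov_eq0 n.+1 n.+2) //.
  nia.
rewrite /sigma -[n.+2.-1]/n.+1; apply/eqP; rewrite eqr_div ?lt0r_neq0 ?ltr0Sn //.
rewrite -!natrM; apply/eqP; congr (_%:R); lia.
Qed.

Lemma sigma_one m : sigma m.+2 1 = m.+2%:R.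
Proof.
have e p : cov p.+1 1 0 = 1%N.
  by elim: p => [//|p IH]; rewrite cov_surj_rec IH.
by rewrite /sigma /= !e; field.
Qed.

(** Induction on the excess [k.+1] of arcs over vertices, then on [n]: [sigma_rec] calls [sigma]
    with one arc and one vertex less, at equal excess, and [rho] with one arc less, at smaller
    excess. The bases are excess one and a single vertex. *)
Lemma sigma_bounds k n x : 0 < x -> zfun x = (n + k.+2)%:R / n.+1%:R ->
  x <= sigma (n + k.+2) n.+1 <= x + 12 / n.+1%:R.
Proof.
elim: k n x => [|k IHk] n x x0 zx.
  rewrite addn2 sigma_diag in zx *; have n0 : 0 < n.+1%:R :> R by rewrite ltr0Sn.
  apply/andP; split.
    have : 1 + x / 2 <= n.+2%:R / n.+1%:R.
      by rewrite -zx /zfun; have := qfun_ge x0; lra.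
    have -> : n.+2%:R / n.+1%:R = 1 + n.+1%:R^-1 :> R.
      by rewrite -[in LHS]addn1 natrD; field; rewrite gt_eqF.
    by move: (n.+1%:R^-1) => i; lra.
  have : 0 <= 10 / n.+1%:R :> R by rewrite divr_ge0 // ltW.
  by move: (n.+1%:R^-1) => i; lra.
elim: n x x0 zx => [|n IHn] x x0 zx.
  rewrite add0n sigma_one; rewrite add0n divr1 in zx.
  rewrite -zx /zfun; have := qfun_gt0 x0; have := qfun_lt1 x0; lra.
have zE : (n.+1 + k.+3 = (n + k.+3).+1)%N by rewrite addSn.
rewrite zE in zx *.
have nk : (0 < n.+1 < n + k.+3)%N by lia.
rewrite sigma_rec //.
set m := (n + k.+3)%N in nk zx *.
have nm : (n.+2 <= m)%N by rewrite /m -addn2 leq_add2l.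
have N0 : 0 < n.+1%:R :> R by rewrite ltr0Sn.
have NM : n.+2%:R + 1 < m.+1%:R :> R by rewrite natr1 ltr_nat /m; lia.
have N2 : 2 <= n.+2%:R :> R by rewrite ler_nat.
have N1 : 1 < n.+2%:R :> R by rewrite ltr1n.
have [y y0 zy] : exists2 y : R, 0 < y & zfun y = m%:R / n.+1%:R.
  by apply: zfun_surj; rewrite ltr_pdivlMr // mul1r ltr_nat; lia.
have [w w0 zw] : exists2 w : R, 0 < w & zfun w = m%:R / n.+2%:R.
  by apply: zfun_surj; rewrite ltr_pdivlMr ?ltr0Sn // mul1r ltr_nat /m; lia.
have /andP[u1 u2] := IHn y y0 zy; rewrite -/m in u1 u2.
have mE : m = (n.+1 + k.+2)%N by rewrite /m addnS addSn.
have [v1 v2] : qfun w - 12 / n.+2%:R <= rho m n.+2 /\ rho m n.+2 <= qfun w.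
  have := IHk n.+1 w w0; rewrite -mE => /(_ zw) /andP[h1 h2].
  have := @rhoD m n.+2; rewrite -zw => /(_ (_ : is_true _)) h.
  have {}h : rho m n.+2 + sigma m n.+2 = zfun w by exact: h.
  move: h h1 h2; rewrite /zfun; move: (12 / n.+2%:R) (rho m n.+2) (sigma m n.+2).
  by move=> c a b h h1 h2; split; lra.
have up : 0 < sigma m n.+1 by apply: sigma_gt0.
have vp : 0 < rho m n.+2 by exact: rho_gt0.
have mS : m%:R = m.+1%:R - 1 :> R by rewrite -[in RHS]addn1 natrD addrK.
have nS : n.+1%:R = n.+2%:R - 1 :> R by rewrite -[in RHS]addn1 natrD addrK.
rewrite mS nS in zy; rewrite mS in zw; rewrite nS in u2.
rewrite -zx.
move: up vp u1 u2 v1 v2; move: (sigma m n.+1) (rho m n.+2) => u v up vp u1 u2 v1 v2.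
have uv : 0 < u + v by rewrite addr_gt0.
have qx := qfun_gt0 x0.
rewrite mulrA ler_pdivlMr // ler_pdivrMr //.
move: N1 N2 NM zx zy zw u2 v1; move: (n.+2)%:R (m.+1)%:R => N M N1 N2 NM zx zy zw u2 v1.
have h1 := @qfun_cross_le M N x y w N1 NM x0 y0 w0 zx zy zw.
apply/andP; split.
  have e1 : x * v <= x * qfun w by rewrite ler_pM2l.
  have e2 : y * qfun x <= u * qfun x by rewrite ler_pM2r.
  by rewrite /zfun; lra.
set k0 := 12 / N.
(* If [qfun x] is at most [12 / N], the bound already follows from [sigma <= zfun x]. *)
have [qk|kq] := leP (qfun x) k0.
  have : (zfun x) * u <= (x + k0) * (u + v).
    by apply: ler_pM; rewrite /zfun; lra.
  by [].
have h2 := @qfun_cross_ge M N x y w N1 NM x0 y0 w0 zx zy zw k0 (12 / (N - 1))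
  N2 erefl erefl kq.
have k00 : 0 <= k0 by apply: divr_ge0 => //; lra.
have h3 : (qfun x - k0) * u <= (qfun x - k0) * (y + 12 / (N - 1)).
  by rewrite ler_pM2l ?subr_gt0.
have h4 : (x + k0) * (qfun w - k0) <= (x + k0) * v.
  by apply: ler_wpM2l => //; lra.
by rewrite /zfun; lra.
Qed.

End SurjectionRatio.

(** * The limit function *)

Section LimitFunction.
Variable R : realType.
Implicit Types (x y : R).

(** The denominator of [main_term] is rewritten as a sum of two positive terms that vanish with [x];
    the shape [a^2 / (a + c)] then yields estimates uniform near 0. *)
Definition gfun x := (1 - qfun x) ^+ 2 / ((1 - qfun x) + x / expR x).

Lemma main_termE x : 0 < x -> main_term x = gfun x.
Proof.
move=> x0; have e0 := lt0r_neq0 (expRB1_gt0 x0); have e1 := lt0r_neq0 (expR_gt0 x).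
rewrite /main_term /gfun /qfun; congr (_ / _); by field; rewrite e0 e1.
Qed.

Lemma quot_bounds (a c : R) : 0 < a -> 0 <= c -> 0 <= a ^+ 2 / (a + c) <= a.
Proof.
move=> a0 c0; have ac : 0 < a + c by lra.
apply/andP; split; first by rewrite divr_ge0 ?sqr_ge0 // ltW.
rewrite ler_pdivrMr //; nra.
Qed.

(** The coefficients of [a' - a] and [c' - c] in the exact difference are at most 1 in absolute
    value, their numerators being parts of the expanded denominator. *)
Lemma quot_lipschitz (a c a' c' : R) : 0 < a -> 0 <= c -> 0 < a' -> 0 <= c' ->
  `|a' ^+ 2 / (a' + c') - a ^+ 2 / (a + c)| <= `|a' - a| + `|c' - c|.
Proof.
move=> a0 c0 a'0 c'0; have ac : 0 < a + c by lra. have ac' : 0 < a' + c' by lra.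
have -> : a' ^+ 2 / (a' + c') - a ^+ 2 / (a + c) =
  ((a' * a + a' * c + a * c') / ((a' + c') * (a + c))) * (a' - a)
  - (a * a' / ((a' + c') * (a + c))) * (c' - c).
  by field; rewrite !gt_eqF.
have d0 : 0 < (a' + c') * (a + c) by rewrite mulr_gt0.
have aa : 0 <= a * a' by rewrite mulr_ge0 ?ltW //.
have ac0 : 0 <= a' * c by rewrite mulr_ge0 // ltW.
have ca0 : 0 <= a * c' by rewrite mulr_ge0 // ltW.
have cc0 : 0 <= c' * c by rewrite mulr_ge0.
apply: le_trans (ler_normB _ _) _; apply: lerD; rewrite normrM ler_piMl //.
  rewrite ger0_norm; first by rewrite ler_pdivrMr //; lra.
  by apply: divr_ge0 (ltW d0); lra.
rewrite ger0_norm; first by rewrite ler_pdivrMr //; lra.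
exact: divr_ge0 (ltW d0).
Qed.

Lemma gfun_bounds x : 0 < x -> 0 <= gfun x <= 1 - qfun x.
Proof.
move=> x0; apply: quot_bounds; first by rewrite subr_gt0 qfun_lt1.
by rewrite divr_ge0 ?expR_ge0 // ltW.
Qed.

Lemma xexpN_lipschitz x y : 0 < x -> x <= y ->
  `|y / expR y - x / expR x| <= y - x.
Proof.
move=> x0 xy.
have d (t : R) : 0 < t -> is_derive t 1 (fun u => u / expR u) ((1 - t) / expR t).
  move=> t0; have e0 := lt0r_neq0 (expR_gt0 t).
  have h : is_derive t 1 (fun u => (expR u)^-1) (- (expR t) ^- 2 *: expR t).
    by apply: is_deriveV.
  apply: is_derive_eq; rewrite /GRing.scale /=; by field.
have b (t : R) : 0 < t -> -1 <= (1 - t) / expR t <= 1.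
  move=> t0; have h := expR_ge1Dx t.
  rewrite ler_pdivlMr ?expR_gt0 // ler_pdivrMr ?expR_gt0 //; lra.
rewrite ler_norml; apply/andP; split.
  suff : x / expR x + x <= y / expR y + y by lra.
  apply: (@le_of_derive R (fun t => t / expR t + t) (fun t => (1 - t) / expR t + 1))
    => // t /andP[xt _]; have t0 : 0 < t by exact: lt_le_trans xt.
    by have h := d t t0; apply: is_derive_eq.
  by have := b t t0; rewrite /=; lra.
suff : x - x / expR x <= y - y / expR y by lra.
apply: (@le_of_derive R (fun t => t - t / expR t) (fun t => 1 - (1 - t) / expR t))
    => // t /andP[xt _]; have t0 : 0 < t by exact: lt_le_trans xt.
  by have h := d t t0; apply: is_derive_eq.
by have := b t t0; rewrite /=; lra.
Qed.

Lemma gfun_lipschitz x y : 0 < x -> x <= y ->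
  `|gfun y - gfun x| <= 3 / 2 * (y - x).
Proof.
move=> x0 xy; have y0 : 0 < y by exact: lt_le_trans xy.
apply: le_trans (quot_lipschitz _ _ _ _) _; rewrite ?subr_gt0 ?qfun_lt1 //;
  try by rewrite divr_ge0 ?expR_ge0 // ltW.
have := xexpN_lipschitz x0 xy; have := qfun_lipschitz x0 xy.
have := qfun_decr x0 xy => h1 h2 h3.
have -> : `|1 - qfun y - (1 - qfun x)| = qfun x - qfun y.
  by rewrite ger0_norm; lra.
lra.
Qed.

(** At [zfun x = M / N] the bound is [2 (M - N) / M]. *)
Lemma one_sub_q_le x : 0 < x -> 1 - qfun x <= 2 * (1 - (zfun x)^-1).
Proof.
move=> x0; have z0 : 0 < zfun x by exact: lt_trans (zfun_gt1 x0).
suff : 2 * (zfun x)^-1 <= 1 + qfun x by lra.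
rewrite ler_pdivrMr //; have q1 := qfun_ge x0; have q0 := qfun_gt0 x0.
rewrite /zfun; have [x2|x2] := leP x 2; nra.
Qed.

(** The numerator is at least [(x q / 2)^2] and the denominator at most [2 x], while
    [zfun x - 1 <= x]. The bound [b] on the mean number of arcs per vertex keeps [q] away from 0. *)
Lemma gfun_ge x b : 0 < x -> zfun x <= b ->
  (zfun x - 1) * (qfun b ^+ 2 / 8) <= gfun x.
Proof.
move=> x0 xb; have a0 : 0 < 1 - qfun x by rewrite subr_gt0 qfun_lt1.
have q0 := qfun_gt0 x0; have q1 := qfun_lt1 x0; have qg := qfun_ge x0.
have b0 : 0 < b by rewrite /zfun in xb; lra.
have qb : 0 < qfun b <= qfun x.
  by rewrite qfun_gt0 //= qfun_decr //; rewrite /zfun in xb; lra.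
have a1 : x * qfun x <= 2 * (1 - qfun x) by have := qfun_le x0; lra.
have c1 : 0 <= x / expR x <= x.
  apply/andP; split; first by rewrite divr_ge0 ?expR_ge0 // ltW.
  rewrite ler_pdivrMr ?expR_gt0 // ler_peMr ?(ltW x0) //.
  by rewrite -expR0 ler_expR ltW.
have z1 : 0 < zfun x - 1 <= x by rewrite subr_gt0 zfun_gt1 //= /zfun; lra.
rewrite /gfun ler_pdivlMr; last by lra.
have h1 : (zfun x - 1) * (qfun b ^+ 2 / 8) <= x * (qfun x ^+ 2 / 8).
  have h0 : qfun b ^+ 2 <= qfun x ^+ 2 by rewrite !expr2; apply: ler_pM; lra.
  apply: ler_pM; [lra| |lra|lra].
  by rewrite divr_ge0 ?sqr_ge0.
have h2 : x * (qfun x ^+ 2 / 8) * (1 - qfun x + x / expR x) <=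
   x * (qfun x ^+ 2 / 8) * (2 * x).
  apply: ler_wpM2l; last by lra.
  by rewrite mulr_ge0 ?divr_ge0 ?sqr_ge0 // ltW.
have h3 : x * (qfun x ^+ 2 / 8) * (2 * x) <= (1 - qfun x) ^+ 2.
  have -> : x * (qfun x ^+ 2 / 8) * (2 * x) = (x * qfun x / 2) ^+ 2 by field.
  have h0 : 0 <= x * qfun x by rewrite mulr_ge0 // ltW.
  by rewrite !expr2; apply: ler_pM; lra.
apply: le_trans h3; apply: le_trans h2; apply: ler_wpM2r h1; lra.
Qed.

End LimitFunction.

(** * One step of the recurrence for the probability *)

Section Iteration.
Variable R : realType.
Implicit Types (M N x y : R).

(** [qfun x ^+ 2 / zfun x] is one minus the denominator of [gfun x]. *)
Lemma gfun_fix x : 0 < x ->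
  gfun x = (1 - qfun x) ^+ 2 + qfun x ^+ 2 / zfun x * gfun x.
Proof.
move=> x0; have e0 := expRB1_gt0 x0; have e1 := expR_gt0 x.
have a0 : 0 < 1 - qfun x by rewrite subr_gt0 qfun_lt1.
have d0 : 0 < 1 - qfun x + x / expR x by rewrite addr_gt0 // divr_gt0.
have z0 : 0 < zfun x by exact: lt_trans (zfun_gt1 x0).
have E : qfun x ^+ 2 / zfun x = 1 - (1 - qfun x + x / expR x).
  by rewrite zfunE // /qfun; field; rewrite !gt_eqF.
by rewrite E mulrBl mul1r /gfun mulrCA mulfV ?gt_eqF // mulr1; ring.
Qed.

(** Each error carries, besides a factor of order [1 / N], a factor of order [(M - N) / M], coming
    from [1 - q], from [gfun y] or from [M - N >= 1]. This makes it comparable with the gain of the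
    contraction. *)
Lemma one_step_error M N x y (rh : R) : 2 <= N -> N + 1 <= M -> 0 < x -> 0 < y ->
  zfun x = M / N -> zfun y = (M - 1) / (N - 1) ->
  0 <= rh -> qfun x - 12 / N <= rh <= qfun x ->
  `|(1 - rh) ^+ 2 + rh ^+ 2 * ((M - N) / ((N - 1) * M))
    + N / M * rh ^+ 2 * gfun y - gfun x| <= 440 * ((M - N) / (N * M)).
Proof.
move=> N2 NM x0 y0 zx zy rh0 /andP[rh1 rh2].
have N0 : 0 < N by lra. have M0 : 0 < M by lra. have N10 : 0 < N - 1 by lra.
have M10 : 0 < M - 1 by lra.
have r1 : 1 <= M - N by lra.
have q0 := qfun_gt0 x0; have q1 := qfun_lt1 x0.
set e := (M - N) / (N * M); set q := qfun x in q0 q1 rh1 rh2 *.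
have rM0 : 0 <= M - N by lra.
have NM0 : 0 <= N / M by apply: divr_ge0; apply: ltW.
have NM1 : N / M <= 1 by rewrite ler_pdivrMr // mul1r; lra.
have iM0 : 0 < M^-1 by rewrite invr_gt0.
have iN0 : 0 < N^-1 by rewrite invr_gt0.
have e0 : 0 <= e by apply: divr_ge0 rM0 _; rewrite mulr_ge0 // ltW.
have eE : e = (M - N) * M^-1 * N^-1 by rewrite /e; field; rewrite !gt_eqF.
have iNM : N^-1 <= 2 * ((M - N) * M^-1).
  rewrite -[N^-1]mul1r mulrA ler_pdivrMr // mulrAC ler_pdivlMr // mul1r; nra.
have iN1 : (N - 1)^-1 <= 2 * N^-1.
  by rewrite -[(N - 1)^-1]mul1r ler_pdivrMr // mulrAC ler_pdivlMr //; lra.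
have iM1 : (M - 1)^-1 <= 2 * M^-1.
  by rewrite -[(M - 1)^-1]mul1r ler_pdivrMr // mulrAC ler_pdivlMr //; lra.
have iMN : M^-1 <= N^-1 by rewrite lef_pV2 ?posrE //; lra.
have ax : 1 - q <= 2 * ((M - N) * M^-1).
  have := one_sub_q_le x0; rewrite zx invf_div.
  by rewrite (_ : 1 - N / M = (M - N) * M^-1) //; field; rewrite gt_eqF.
have xy : x <= y.
  apply: ler_zfun_inv => //; rewrite zx zy ler_pdivrMr // mulrAC ler_pdivlMr //; lra.
have yx : y - x <= 2 * ((M - N) * N^-1 * (N - 1)^-1).
  have := le_zfun2 x0 xy; rewrite zx zy.
  rewrite (_ : (M - 1) / (N - 1) - M / N = (M - N) * N^-1 * (N - 1)^-1) //.
  by field; rewrite !gt_eqF.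
have /andP[g0 g1] := gfun_bounds y0.
have gy : gfun y <= 4 * ((M - N) * M^-1).
  apply: le_trans g1 _; apply: le_trans (one_sub_q_le y0) _.
  rewrite zy invf_div (_ : 1 - (N - 1) / (M - 1) = (M - N) * (M - 1)^-1); last first.
    by field; rewrite gt_eqF.
  have h : (M - N) * (M - 1)^-1 <= (M - N) * (2 * M^-1) by apply: ler_wpM2l; lra.
  by lra.
have gl := gfun_lipschitz x0 xy.
have gfx : gfun x = (1 - q) ^+ 2 + q ^+ 2 * (N / M) * gfun x.
  by rewrite {1}(gfun_fix x0) zx invf_div.
(* The fixed-point equation is subtracted; the four pieces cost 336, 2, 96 and 6, in total 440. *)
rewrite (_ : _ - gfun x = ((1 - rh) ^+ 2 - (1 - q) ^+ 2)
  + rh ^+ 2 * ((M - N) / ((N - 1) * M))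
  - N / M * (q ^+ 2 - rh ^+ 2) * gfun y
  + N / M * q ^+ 2 * (gfun y - gfun x)); last first.
  by rewrite [in LHS]gfx; ring.
have t1 : `|(1 - rh) ^+ 2 - (1 - q) ^+ 2| <= 336 * e.
  have -> : (1 - rh) ^+ 2 - (1 - q) ^+ 2 = (q - rh) * (2 * (1 - q) + (q - rh)) by ring.
  have d0 : 0 <= q - rh by rewrite subr_ge0.
  have d1 : q - rh <= 12 * N^-1 by clear -rh1; lra.
  rewrite ger0_norm; last by apply: mulr_ge0 => //; clear -d0 q1; lra.
  have : (q - rh) * (2 * (1 - q) + (q - rh)) <=
         12 * N^-1 * (2 * (2 * ((M - N) * M^-1)) + 12 * (2 * ((M - N) * M^-1))).
    apply: ler_pM; [exact: d0| |exact: d1|]; clear -d0 d1 q1 iNM ax; lra.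
  by rewrite eE; clear; lra.
have t2 : `|rh ^+ 2 * ((M - N) / ((N - 1) * M))| <= 2 * e.
  have rr : rh ^+ 2 <= 1 by rewrite expr_le1 // (le_trans rh2) // ltW.
  have p0 : 0 <= (M - N) * M^-1 by apply: mulr_ge0 rM0 (ltW iM0).
  have -> : (M - N) / ((N - 1) * M) = (M - N) * M^-1 * (N - 1)^-1.
    by field; rewrite !gt_eqF.
  have p1 : 0 <= (M - N) * M^-1 * (N - 1)^-1 by rewrite mulr_ge0 // invr_ge0 ltW.
  rewrite ger0_norm; last by rewrite mulr_ge0 ?sqr_ge0.
  apply: le_trans (_ : 1 * ((M - N) * M^-1 * (N - 1)^-1) <= _).
    exact: ler_wpM2r.
  have := ler_wpM2l p0 iN1; rewrite eE; clear; lra.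
have t3 : `|N / M * (q ^+ 2 - rh ^+ 2) * gfun y| <= 96 * e.
  have d0 : 0 <= q ^+ 2 - rh ^+ 2 <= 24 * N^-1.
    have d1 : q - rh <= 12 * N^-1 by clear -rh1; lra.
    clear -d1 rh0 rh2 q1; rewrite subr_sqr; apply/andP; split.
      by apply: mulr_ge0; lra.
    rewrite (_ : 24 * N^-1 = 12 * N^-1 * 2); last by ring.
    by apply: ler_pM; lra.
  have /andP[d1 d2] := d0.
  have p0 : 0 <= N / M * (q ^+ 2 - rh ^+ 2) by rewrite mulr_ge0.
  rewrite ger0_norm; last by rewrite mulr_ge0.
  have h1 : N / M * (q ^+ 2 - rh ^+ 2) <= 24 * N^-1.
    by rewrite -[24 * _]mul1r; apply: ler_pM.
  have : N / M * (q ^+ 2 - rh ^+ 2) * gfun y <=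
     24 * N^-1 * (4 * ((M - N) * M^-1)) by apply: ler_pM.
  by rewrite eE; clear; lra.
have t4 : `|N / M * q ^+ 2 * (gfun y - gfun x)| <= 6 * e.
  have qq : q ^+ 2 <= 1 by rewrite expr_le1 // ltW.
  rewrite normrM ger0_norm; last by rewrite mulr_ge0 ?sqr_ge0.
  have h1 : N / M * q ^+ 2 <= N / M by rewrite ler_piMr.
  have h2 : `|gfun y - gfun x| <= 3 * ((M - N) * N^-1 * (2 * N^-1)).
    have : (M - N) * N^-1 * (N - 1)^-1 <= (M - N) * N^-1 * (2 * N^-1).
      by apply: ler_wpM2l => //; apply: mulr_ge0 rM0 (ltW iN0).
    by clear -gl yx; lra.
  have : N / M * q ^+ 2 * `|gfun y - gfun x| <=
     N / M * (3 * ((M - N) * N^-1 * (2 * N^-1))).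
    by apply: ler_pM => //; rewrite mulr_ge0 ?sqr_ge0.
  have -> : N / M * (3 * ((M - N) * N^-1 * (2 * N^-1))) = 6 * e.
    by rewrite eE; field; rewrite !gt_eqF.
  by [].
apply: le_trans (ler_normD _ _) _; apply: le_trans (lerD (ler_normB _ _) (lexx _)) _.
have := ler_normD ((1 - rh) ^+ 2 - (1 - q) ^+ 2) (rh ^+ 2 * ((M - N) / ((N - 1) * M))).
clear -t1 t2 t3 t4; lra.
Qed.

(* The contraction factor N/M * rho ^ 2 is at most (N/M)^2, which absorbs the
   error made at each step. *)
Lemma error_contraction M N (f A : R) : 0 <= A -> 2 <= N -> N + 2 <= M ->
  0 <= f -> f <= (N / M) ^+ 2 ->
  A * ((M - N) / (N * M)) + f * (2 * A / (N - 1)) <= 2 * A / N.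
Proof.
move=> A0 N2 NM f0 fNM.
have N0 : 0 < N by lra. have M0 : 0 < M by lra. have N10 : 0 < N - 1 by lra.
have : f * (2 * A / (N - 1)) <= (N / M) ^+ 2 * (2 * A / (N - 1)).
  by apply: ler_wpM2r => //; apply: divr_ge0; lra.
move=> h; apply: le_trans (lerD (lexx _) h) _.
rewrite -subr_ge0.
have -> : 2 * A / N - (A * ((M - N) / (N * M)) + (N / M) ^+ 2 * (2 * A / (N - 1))) =
  A * (2 * (N - 1) * M ^+ 2 - (M - N) * M * (N - 1) - 2 * N ^+ 3)
   / (N * (N - 1) * M ^+ 2).
  by field; rewrite !gt_eqF.
apply: divr_ge0; last by rewrite !mulr_ge0 ?sqr_ge0 //; lra.
set r := M - N; have -> : M = N + r by rewrite /r; ring.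
have r2 : 2 <= r by rewrite /r; lra.
apply: mulr_ge0 => //.
have -> : 2 * (N - 1) * (N + r) ^+ 2 - r * (N + r) * (N - 1) - 2 * N ^+ 3 =
  N * (N * (3 * r - 2) - 3 * r) + r ^+ 2 * (N - 1) by ring.
apply: addr_ge0; last by rewrite mulr_ge0 ?sqr_ge0 // ltW.
by apply: mulr_ge0; [exact: ltW|nra].
Qed.

End Iteration.

(** * The probability of having no sink or source cycle *)

Section NoCycleProbability.
Local Arguments cov : simpl never.
Variable R : realType.

Lemma natr_cov_gt0 p c : (0 < c <= p)%N -> 0 < (cov p c 0)%:R :> R.
Proof. by move=> h; rewrite ltr0n cov_gt0. Qed.

Definition no_cycle_prob (m n : nat) : R :=
  good_count R m n / (cov m n 0)%:R ^+ 2.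

Lemma no_cycle_prob_rec m n : (0 < n < m)%N ->
  no_cycle_prob m.+1 n.+1 =
  (1 - rho R m.+1 n.+1) ^+ 2
  + rho R m.+1 n.+1 ^+ 2 * ((m%:R - n%:R) / (n%:R * m.+1%:R))
  + n.+1%:R / m.+1%:R * rho R m.+1 n.+1 ^+ 2 * no_cycle_prob m n.
Proof.
case: m n => [|m] [|n] // /andP[_ nm].
have s1 : 0 < (cov m.+1 n.+1 0)%:R :> R by apply: natr_cov_gt0 => /=; exact: ltnW.
have s2 : 0 < (cov m.+2 n.+2 0)%:R :> R by apply: natr_cov_gt0 => /=; exact: ltnW.
(* A surjection onto [c + 1] points is a value at one argument together with a map of the others for
   which this value is the one free point. *)
have e1 : (cov m.+1 n.+1 1)%:R = (cov m.+2 n.+2 0)%:R / n.+2%:R :> R.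
  by rewrite [cov m.+2 _ _]/cov -/cov mul0n addn0 natrM mulrC mulKf // pnatr_eq0.
have e2 : (cov m n 1)%:R = (cov m.+1 n.+1 0)%:R / n.+1%:R :> R.
  by rewrite [cov m.+1 _ _]/cov -/cov mul0n addn0 natrM mulrC mulKf // pnatr_eq0.
rewrite /no_cycle_prob /rho good_countS /core_count /predn /Nat.pred e1 e2.
have m2 : m.+2%:R = m.+1%:R + 1 :> R by rewrite natr1.
have n2 : n.+2%:R = n.+1%:R + 1 :> R by rewrite natr1.
have m0 : 0 < m.+1%:R :> R by rewrite ltr0Sn.
have n0 : 0 < n.+1%:R :> R by rewrite ltr0Sn.
rewrite m2 n2; move: s1 s2 m0 n0.
move: (cov m.+1 n.+1 0)%:R (cov m.+2 n.+2 0)%:R m.+1%:R n.+1%:R (good_count _ _ _).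
move=> s S M N g s0 S0 M0 N0; field.
by rewrite !gt_eqF // addr_gt0.
Qed.

(** With one vertex and at least two arcs the loop is multiple, hence not a cycle. *)
Lemma no_cycle_prob_one m : no_cycle_prob m.+2 1 = 1.
Proof.
have e p : cov p.+1 1 0 = 1%N.
  by elim: p => [//|p IH]; rewrite cov_surj_rec IH.
rewrite /no_cycle_prob good_countS /good_count big_ord1 /core_count !subn0 /=.
rewrite !e; rewrite (_ : cov m.+1 0 0 = 0%N); last by rewrite /cov -/cov; lia.
by rewrite !(mulr0, mul0r, expr0n) /=; field.
Qed.

(** The recurrence keeps the excess [k.+1], so [k] is fixed in the induction on [n]; [0 < k]
    provides the excess 2 that [error_contraction] asks for. At one vertex both quantities lie in
    [[0, 1]]. *)
Lemma no_cycle_prob_approx k n (x : R) : (0 < k)%N -> 0 < x ->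
  zfun x = (n + k.+2)%:R / n.+1%:R ->
  `|no_cycle_prob (n + k.+2) n.+1 - gfun x| <= 2 * 440 / n.+1%:R.
Proof.
move=> k0; elim: n x => [|n IHn] x x0 zx.
  rewrite add0n no_cycle_prob_one divr1.
  have /andP[g0 g1] := gfun_bounds x0; have q0 := qfun_gt0 x0.
  by rewrite ger0_norm; lra.
rewrite addSn in zx *; set m := (n + k.+2)%N in zx *.
have nm : (0 < n.+1 < m)%N by rewrite /m; lia.
rewrite no_cycle_prob_rec //.
have mnE : (n.+1 + k.+2 = m.+1)%N by rewrite /m; lia.
have bnd := @sigma_bounds R k n.+1 x x0; rewrite mnE in bnd.
have /andP[s1 s2] := bnd zx.
have rD := @rhoD R m.+1 n.+2; rewrite -zx in rD.
have {}rD : rho R m.+1 n.+2 + sigma R m.+1 n.+2 = zfun x by apply: rD; lia.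
have rp : 0 < rho R m.+1 n.+2 by apply: rho_gt0; lia.
have [y y0 zy] : exists2 y : R, 0 < y & zfun y = m%:R / n.+1%:R.
  by apply: zfun_surj; rewrite ltr_pdivlMr // mul1r ltr_nat; lia.
have IH := IHn y y0 zy.
have mS : m%:R = m.+1%:R - 1 :> R by rewrite -[in RHS]natr1 addrK.
have nS : n.+1%:R = n.+2%:R - 1 :> R by rewrite -[in RHS]natr1 addrK.
have N2 : 2 <= n.+2%:R :> R by rewrite ler_nat.
have NM : n.+2%:R + 2 <= m.+1%:R :> R by rewrite -natrD ler_nat /m; lia.
rewrite mS nS in zy IH *.
rewrite -/m in IH.
move: rp rD s1 s2 IH; move: (rho R m.+1 n.+2) (sigma R m.+1 n.+2) (no_cycle_prob m n.+1).
move=> rh sg P rp rD s1 s2 IH.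
move: N2 NM zx zy s2 IH; move: (n.+2)%:R (m.+1)%:R => N M N2 NM zx zy s2 IH.
have rq : qfun x - 12 / N <= rh <= qfun x by rewrite /zfun in rD; apply/andP; split; lra.
have NM1 : N + 1 <= M by lra.
have h1 := one_step_error N2 NM1 x0 y0 zx zy (ltW rp) rq.
have N0 : 0 < N by lra. have M0 : 0 < M by lra.
have f0 : 0 <= N / M * rh ^+ 2 by rewrite mulr_ge0 ?sqr_ge0 // divr_ge0 // ltW.
have f1 : N / M * rh ^+ 2 <= (N / M) ^+ 2.
  have /andP[_ rq2] := rq.
  have zq := zq_le1 x0; rewrite zx in zq.
  have q1 := qfun_lt1 x0.
  have qN : qfun x <= N / M.
    by rewrite ler_pdivlMr // mulrC; move: zq; rewrite mulrAC ler_pdivrMr // mul1r.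
  rewrite [(N / M) ^+ 2]expr2 ler_wpM2l //; first by rewrite divr_ge0 // ltW.
  apply: le_trans qN; apply: le_trans rq2.
  by rewrite expr2 ler_piMr ?(ltW rp) //; lra.
have A0 : 0 <= 440 :> R by rewrite ler0n.
have h2 := error_contraction A0 N2 NM f0 f1.
have -> : M - 1 - (N - 1) = M - N by ring.
have e : (1 - rh) ^+ 2 + rh ^+ 2 * ((M - N) / ((N - 1) * M)) + N / M * rh ^+ 2 * P - gfun x =
  ((1 - rh) ^+ 2 + rh ^+ 2 * ((M - N) / ((N - 1) * M)) + N / M * rh ^+ 2 * gfun y - gfun x)
  + N / M * rh ^+ 2 * (P - gfun y) by ring.
rewrite e; apply: le_trans (ler_normD _ _) _; apply: le_trans h2; apply: lerD => //.
by rewrite normrM ger0_norm // ler_wpM2l.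
Qed.

(** The absolute error [B / n] is divided by the lower bound [c (m - n) / n] of [gfun_ge], so that
    [n] cancels. *)
Lemma no_cycle_prob_relative_error (b : R) : 0 < b ->
  exists2 A : R, 0 < A & forall (m n : nat) (x : R),
    (0 < n)%N -> (n + 2 < m)%N -> 0 < x ->
    zfun x = m%:R / n%:R -> m%:R <= b * n%:R ->
    0 < gfun x /\
    `|no_cycle_prob m n - gfun x| / gfun x <= A * (m%:R - n%:R)^-1.
Proof.
move=> b0.
have B0 : 0 < 2 * 440 :> R by rewrite -natrM ltr0n.
have approx := no_cycle_prob_approx.
move: B0 approx; move: (2 * 440 : R) => B B0 approx.
have c0 : 0 < qfun b ^+ 2 / 8 by rewrite divr_gt0 // exprn_gt0 // qfun_gt0.
exists (B / (qfun b ^+ 2 / 8)) => [|m n x n0 nm x0 zx mb]; first exact: divr_gt0.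
have appr : `|no_cycle_prob m n - gfun x| <= B / n%:R.
  have nE : n = n.-1.+1 by rewrite prednK.
  have [k k0 mE] : exists2 k, (0 < k)%N & m = (n.-1 + k.+2)%N.
    by clear -n0 nm; exists (m - n).-1; lia.
  have := approx k n.-1 x k0 x0; rewrite -mE -nE; exact.
have nR : 0 < n%:R :> R by rewrite ltr0n.
have mn : 0 < m%:R - n%:R :> R.
  by rewrite subr_gt0 ltr_nat; clear -nm; lia.
have zb : zfun x <= b by rewrite zx ler_pdivrMr.
have gc := gfun_ge x0 zb; move: c0 gc appr; move: (qfun b ^+ 2 / 8) => c c0.
have -> : zfun x - 1 = (m%:R - n%:R) / n%:R.
  by rewrite zx; field; rewrite gt_eqF.
move: mn nR; move: (n%:R : R) (m%:R - n%:R) => N r mn nR gc appr.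
have g0 : 0 < gfun x by apply: lt_le_trans gc; rewrite mulr_gt0 // divr_gt0.
split=> //; rewrite ler_pdivrMr //; apply: le_trans appr _.
have h : B / c * r^-1 * (r / N * c) <= B / c * r^-1 * gfun x.
  by rewrite ler_pM2l // mulr_gt0 ?invr_gt0 // divr_gt0.
apply: le_trans h; rewrite le_eqVlt; apply/orP; left; apply/eqP.
by field; rewrite !gt_eqF.
Qed.

End NoCycleProbability.

(** * The asymptotic statement *)

Lemma prob_X_eq0E (R : realType) (m n : nat) :
  (0 < n)%N -> prob_X_eq0 R n m = no_cycle_prob R m n.
Proof.
move=> n0; pose v0 := Ordinal n0.
rewrite /no_cycle_prob /good_count -(card_good_ends _ R v0) -natrX.
rewrite -(card_sequences_1_1 m v0) /prob_X_eq0 /uniform_prob.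
by congr (_%:R / _); exact: card_no_cycle_sequences.
Qed.

Theorem theorem4p2 (R : realType) (m : nat -> nat) (lam : nat -> R)
    (r := fun n : nat => (m n)%:R - n%:R : R)
    (r_infty : r n @[n --> \oo] --> +oo)
    (m_bigO : (fun n : nat => (m n)%:R : R^o) =O_\oo (fun n : nat => n%:R : R^o))
    (lam_root : \forall n \near \oo, 0 < lam n /\
      lam n * expR (lam n) / (expR (lam n) - 1) = (m n)%:R / n%:R) :
  exists2 eps : nat -> R^o,
    eps =O_\oo (fun n : nat => (r n)^-1 * ln (r n) ^+ 2 : R^o) &
    \forall n \near \oo,
      prob_X_eq0 R n (m n) = main_term (lam n) * (1 + eps n).
Proof.
have [b b0 mb] : exists2 b : R, 0 < b &
    \forall n \near \oo, `|(m n)%:R : R| <= b * `|n%:R : R|.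
  by have /eqO_exP := m_bigO.
have rbig A : \forall n \near \oo, A <= r n by move/cvgryPge: r_infty; apply.
have n1 : \forall n \near \oo, (0 < n)%N by exists 1%N.
have [A A0 errA] := no_cycle_prob_relative_error b0.
have main : \forall n \near \oo, [/\ 0 < gfun (lam n), main_term (lam n) = gfun (lam n),
    prob_X_eq0 R n (m n) = no_cycle_prob R (m n) n, expR 1 <= r n &
    `|no_cycle_prob R (m n) n - gfun (lam n)| / gfun (lam n) <=
      A * (r n)^-1].
  near=> n.
  have n0 : (0 < n)%N by near: n.
  have [l0 lE] : 0 < lam n /\
    lam n * expR (lam n) / (expR (lam n) - 1) = (m n)%:R / n%:R by near: n.
  (* The bound 3 gives [n + 2 < m n] below, and the bound [expR 1] will give [1 <= ln (r n)]. *)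
  have r3 : 3 <= r n by near: n; exact: rbig.
  have re : expR 1 <= r n by near: n; exact: rbig.
  have mn : `|(m n)%:R : R| <= b * `|n%:R : R| by near: n.
  have zE : zfun (lam n) = (m n)%:R / n%:R by rewrite zfunE.
  have mn3 : (n + 2 < m n)%N.
    by move: r3; rewrite /r lerBrDr -natrD ler_nat addnC addnS.
  have mb' : (m n)%:R <= b * n%:R by move: mn; rewrite !ger0_norm // ler0n.
  have [g0 err] := errA _ _ _ n0 mn3 l0 zE mb'.
  by split => //; [exact: main_termE|exact: prob_X_eq0E].
(* [eps] is the exact relative error, so the equation only needs a nonzero main term. *)
exists (fun n => prob_X_eq0 R n (m n) / main_term (lam n) - 1); last first.
  near=> n.
  have [g0 -> _ _ _] : [/\ 0 < gfun (lam n), main_term (lam n) = gfun (lam n),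
    prob_X_eq0 R n (m n) = no_cycle_prob R (m n) n, expR 1 <= r n &
    `|no_cycle_prob R (m n) n - gfun (lam n)| / gfun (lam n) <=
      A * (r n)^-1] by near: n.
  by rewrite addrC subrK mulrC divfK // gt_eqF.
apply/eqO_exP; exists A => //.
near=> n.
have [g0 -> -> re h] : [/\ 0 < gfun (lam n), main_term (lam n) = gfun (lam n),
    prob_X_eq0 R n (m n) = no_cycle_prob R (m n) n, expR 1 <= r n &
    `|no_cycle_prob R (m n) n - gfun (lam n)| / gfun (lam n) <=
      A * (r n)^-1] by near: n.
have r0 : 0 < r n by apply: lt_le_trans re; exact: expR_gt0.
(* The relative error is in fact [O(1 / r)]; the squared logarithm only weakens the bound. *)
have ln1 : 1 <= ln (r n) by rewrite -[leLHS](@expRK R) ler_ln ?posrE ?expR_gt0.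
rewrite -[X in `|_ - X|](divff (lt0r_neq0 g0)) -mulrBl normrM normfV.
rewrite (gtr0_norm g0); apply: le_trans h _.
apply: ler_wpM2l; first exact: ltW.
rewrite ger0_norm; last first.
  by rewrite mulr_ge0 ?sqr_ge0 // invr_ge0 ltW.
by rewrite ler_peMr ?invr_ge0 ?(ltW r0) // exprn_ege1.
Unshelve. all: by end_near.
Qed.
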